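(* Let $W_n^{0,\rm L}(x_1,\dots,x_n;N,a)$ be the leading low temperature coefficient of the $n$-point function of the Laguerre $\beta$-ensemble with weight $x^{\beta a/2}e^{-\beta x/2}\chi_{x>0}$, and $W_n^{0,\rm L^*}(x_1,\dots,x_n;\alpha,a)$ the scaled high temperature limit of the $n$-point function of the Laguerre $\beta$-ensemble with weight $x^ae^{-x}\chi_{x>0}$, with respective expansion coefficients $\mu^{0,\rm L}_{p_1,\dots,p_n}(N,a)$ and $\mu^{0,\rm L^*}_{p_1,\dots,p_n}(\alpha,a)$. Then for every $n\ge1$ $$-\frac1N\,W_n^{0,\rm L}(x_1,\dots,x_n;N,a)=W_n^{0,\rm L^*}(-x_1,\dots,-x_n;-N,-a)$$ and, for all nonnegative integers $p_1,\dots,p_n$, $$\frac1N\,\mu^{0,\rm L}_{p_1,\dots,p_n}(N,a)=(-1)^{p_1+\cdots+p_n+n-1}\,\mu^{0,\rm L^*}_{p_1,\dots,p_n}(-N,-a).$$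
   Context: For a weight $w$ on $(0,\infty)$ and $\kappa=\beta/2>0$, consider the density on $(0,\infty)^N$ proportional to $\prod_{l=1}^Nw(\lambda_l)\prod_{1\le j<k\le N}|\lambda_k-\lambda_j|^{2\kappa}$. Let $\mu_{p_1,\dots,p_n}$ be the mixed (joint) cumulant of $\sum_j\lambda_j^{p_1},\dots,\sum_j\lambda_j^{p_n}$ (for $n=1$, the moment $\langle\sum_j\lambda_j^{p_1}\rangle$), and define the formal series $\overline W_n(x_1,\dots,x_n)=\frac1{x_1\cdots x_n}\sum_{p_1,\dots,p_n\ge0}\mu_{p_1,\dots,p_n}x_1^{-p_1}\cdots x_n^{-p_n}$. Write $\overline W_n^{\rm L}(x_1,\dots,x_n;N,\kappa,a)$ for weight $w(x)=x^{\kappa a}e^{-\kappa x}$ and $\overline W_n^{\rm L^*}(x_1,\dots,x_n;N,\kappa,a)$ for weight $w(x)=x^ae^{-x}$. The quantities in the claim are defined (coefficientwise) by the leading terms $$\overline W_n^{\rm L}(x_1,\dots,x_n;N,\kappa,a)=\frac1{\kappa^{n-1}}W_n^{0,\rm L}(x_1,\dots,x_n;N,a)+\cdots\quad(\kappa\to\infty),$$ $$\frac1N\overline W_n^{\rm L^*}(x_1,\dots,x_n;N,\kappa,a)\Big|_{\kappa=\alpha/N}=W_n^{0,\rm L^*}(x_1,\dots,x_n;\alpha,a)+\cdots\quad(N\to\infty,\ \alpha\text{ fixed}),$$ with expansions $$W_n^{0,\rm L}(x_1,\dots,x_n;N,a)=\frac1{x_1\cdots x_n}\sum_{p_1,\dots,p_n\ge0}\frac{\mu^{0,\rm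 L}_{p_1,\dots,p_n}(N,a)}{x_1^{p_1}\cdots x_n^{p_n}},\qquad W_n^{0,\rm L^*}(x_1,\dots,x_n;\alpha,a)=\frac1{x_1\cdots x_n}\sum_{p_1,\dots,p_n\ge0}\frac{\mu^{0,\rm L^*}_{p_1,\dots,p_n}(\alpha,a)}{x_1^{p_1}\cdots x_n^{p_n}}.$$ The coefficients are polynomials in $(N,a)$, respectively $(\alpha,a)$, and are extended to all parameter values by polynomiality, so that evaluation at $(\alpha,a)\mapsto(-N,-a)$ makes sense. Identities of generating functions are between formal series. *)

(* Defs.v *)
From HB Require Import structures.
From mathcomp Require Import all_boot all_order all_algebra.
From mathcomp Require Import all_classical all_reals all_analysis.
Set Implicit Arguments.
Unset Strict Implicit.
Unset Printing Implicit Defensive.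
Import Order.TTheory GRing.Theory Num.Theory.
Import numFieldNormedType.Exports.
Local Open Scope classical_set_scope.
Local Open Scope ring_scope.

Section beta_ensemble.
Context {R : realType}.

Definition tuple_cons (N : nat) (xt : measurableTypeR R * N.-tuple (measurableTypeR R)) : N.+1.-tuple (measurableTypeR R) :=
  [tuple of xt.1 :: xt.2].

Lemma measurable_tuple_cons (N : nat) : measurable_fun setT (@tuple_cons N).
Proof. exact: measurable_cons. Qed.

Section lebesgue_cons.
Variables (N : nat) (mu : {sigma_finite_measure set (N.-tuple (measurableTypeR R)) -> \bar R}).

Definition lebesgue_cons : set (N.+1.-tuple (measurableTypeR R)) -> \bar R :=
  pushforward (lebesgue_measure \x mu)%E (@tuple_cons N).

Let lebesgue_cons0 : lebesgue_cons set0 = 0%E.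
Proof. by rewrite /lebesgue_cons /pushforward preimage_set0 measure0. Qed.

Let lebesgue_cons_ge0 A : (0 <= lebesgue_cons A)%E.
Proof. by rewrite /lebesgue_cons /pushforward measure_ge0. Qed.

Let lebesgue_cons_sigma_additive : semi_sigma_additive lebesgue_cons.
Proof.
move=> F mF tF mUF; rewrite /lebesgue_cons /pushforward preimage_bigcup.
have mcons A : measurable A -> measurable (@tuple_cons N @^-1` A).
  by move=> mA; rewrite -[X in measurable X]setTI; exact: measurable_tuple_cons.
apply: measure_semi_sigma_additive.
- by move=> k; exact: mcons.
- apply/trivIsetP => /= i j _ _ ij; rewrite -preimage_setI.
  by move/trivIsetP : tF => /(_ _ _ _ _ ij) ->//; rewrite preimage_set0.
- by rewrite -preimage_bigcup; exact: mcons.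
Qed.

HB.instance Definition _ := isMeasure.Build _ _ _ lebesgue_cons
  lebesgue_cons0 lebesgue_cons_ge0 lebesgue_cons_sigma_additive.

Lemma sigma_finite_lebesgue_cons : sigma_finite setT lebesgue_cons.
Proof.
have /sigma_finiteP[F [TF ndF Foo]] := sigma_finiteT (@lebesgue_measure R).
have /sigma_finiteP[G [TG ndG Goo]] := sigma_finiteT mu.
pose u (t : N.+1.-tuple (measurableTypeR R)) := (thead t, [tuple of behead t]).
have mu_ : measurable_fun setT u.
  apply/measurable_fun_pairP; split; first exact: measurable_tnth.
  exact: measurable_behead.
have uK : cancel (@tuple_cons N) u.
  by move=> [x t]; congr (_, _); apply: val_inj.
exists (fun i => u @^-1` (F i `*` G i)).
  apply/esym/seteqP; split=> // t _.
  have [k _ Fk] : (\bigcup_i F i) (thead t) by rewrite -TF.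
  have [l _ Gl] : (\bigcup_i G i) [tuple of behead t] by rewrite -TG.
  exists (maxn k l) => //; split => /=.
  - by move: Fk; exact/subsetPset/ndF/leq_maxl.
  - by move: Gl; exact/subsetPset/ndG/leq_maxr.
move=> i; have [mF Fi] := Foo i; have [mG Gi] := Goo i; split.
  rewrite -[X in measurable X]setTI; apply: mu_ => //; exact: measurableX.
rewrite /lebesgue_cons /pushforward -comp_preimage.
rewrite (_ : u \o @tuple_cons N = idfun); last by apply/funext => x; exact: uK.
by rewrite preimage_id product_measure1E// lte_mul_pinfty// ge0_fin_numE.
Qed.

HB.instance Definition _ := Measure_isSigmaFinite.Build _ _ _ lebesgue_cons
  sigma_finite_lebesgue_cons.

End lebesgue_cons.

(* Lebesgue measure on R^N, as an iterated product measure. *)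
Fixpoint lebesgue_tuple (N : nat) :
    {sigma_finite_measure set (N.-tuple (measurableTypeR R)) -> \bar R} :=
  match N return {sigma_finite_measure set (N.-tuple (measurableTypeR R)) -> \bar R} with
  | 0 => \d_ [tuple]
  | M.+1 => lebesgue_cons (lebesgue_tuple M)
  end.

Definition pos_orthant (N : nat) : set (N.-tuple (measurableTypeR R)) :=
  [set t | forall l, 0 < (tnth t l : R)].

Definition beta_weight (w : R -> R) (kappa : R) (N : nat) (t : N.-tuple (measurableTypeR R)) : R :=
  (\prod_(l < N) w (tnth t l : R)) *
  \prod_(j < N) \prod_(k < N | (j < k)%N)
     `|(tnth t k : R) - (tnth t j : R)| `^ (2 * kappa).

Definition beta_average (w : R -> R) (kappa : R) (N : nat)
    (f : N.-tuple (measurableTypeR R) -> R) : R :=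
  (\int[lebesgue_tuple N]_(t in @pos_orthant N) (f t * beta_weight w kappa t)) /
  (\int[lebesgue_tuple N]_(t in @pos_orthant N) beta_weight w kappa t).

Definition power_sum (N p : nat) (t : N.-tuple (measurableTypeR R)) : R :=
  \sum_(j < N) (tnth t j : R) ^+ p.

(* Moments-to-cumulants formula; [E] is the expectation functional. *)
Definition joint_cumulant (T : Type) (E : (T -> R) -> R) (n : nat)
    (X : 'I_n -> T -> R) : R :=
  \sum_(P : {set {set 'I_n}} | finset.partition P [set: 'I_n]%SET)
     (-1) ^+ (#|P|.-1) * (#|P|.-1)`!%:R *
     \prod_(B in P) E (fun t => \prod_(i in B) X i t).

Definition mixed_cumulant (w : R -> R) (kappa : R) (N n : nat)
    (p : 'I_n -> nat) : R :=
  joint_cumulant (@beta_average w kappa N) (fun i => @power_sum N (p i)).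

(* A formal series in x_1^-1, ..., x_n^-1: [s e] is the coefficient of
   x_1^-(e 0) ... x_n^-(e n.-1). *)
Definition inv_series (n : nat) := ('I_n -> nat) -> R.

(* (x_1 ... x_n)^-1 \sum_p c_p x_1^-p_1 ... x_n^-p_n *)
Definition generating_series (n : nat) (c : ('I_n -> nat) -> R) :
    inv_series n :=
  fun e => if [forall i, (0 < e i)%N] then c (fun i => (e i).-1) else 0.

Definition series_scale (n : nat) (c : R) (s : inv_series n) : inv_series n :=
  fun e => c * s e.

(* s(-x_1, ..., -x_n) *)
Definition series_opp_args (n : nat) (s : inv_series n) : inv_series n :=
  fun e => (-1) ^+ (\sum_(i < n) e i)%N * s e.

Definition laguerre_low_weight (kappa a x : R) : R :=
  x `^ (kappa * a) * expR (- (kappa * x)).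

Definition laguerre_high_weight (a x : R) : R := x `^ a * expR (- x).

Definition W_L (n N : nat) (kappa a : R) : inv_series n :=
  generating_series (mixed_cumulant (laguerre_low_weight kappa a) kappa N (n:=n)).

Definition W_Ls (n N : nat) (kappa a : R) : inv_series n :=
  generating_series (mixed_cumulant (laguerre_high_weight a) kappa N (n:=n)).

(* Bivariate polynomials in (N, a), resp. (alpha, a), are elements of
   {poly {poly R}}, evaluated by the notation P.[x, y] of polyXY.
   The parameter ranges are those where the densities are integrable
   (for every large kappa in the low temperature case, hence 0 <= a). *)
Definition low_leading_coef (n : nat) (p : 'I_n -> nat)
    (P : {poly {poly R}}) : Prop :=
  forall (N : nat) (a : R), (0 < N)%N -> 0 <= a ->
    kappa ^+ n.-1 *
      mixed_cumulant (laguerre_low_weight kappa a) kappa N p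
      @[kappa --> +oo] --> P.[N%:R, a].

Definition high_leading_coef (n : nat) (p : 'I_n -> nat)
    (P : {poly {poly R}}) : Prop :=
  forall alpha a : R, 0 < alpha -> -1 < a ->
    N%:R^-1 *
      mixed_cumulant (laguerre_high_weight a) (alpha / N%:R) N p
      @[N --> \oo] --> P.[alpha, a].

(* The polynomial is unique when it exists: each parameter range above
   contains a product of two infinite sets. *)
Definition mu0_poly_L (n : nat) (p : 'I_n -> nat) : {poly {poly R}} :=
  xget 0 (low_leading_coef p).

Definition mu0_poly_Ls (n : nat) (p : 'I_n -> nat) : {poly {poly R}} :=
  xget 0 (high_leading_coef p).

Definition mu0_L (n : nat) (N a : R) (p : 'I_n -> nat) : R :=
  (mu0_poly_L p).[N, a].

Definition mu0_Ls (n : nat) (alpha a : R) (p : 'I_n -> nat) : R :=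
  (mu0_poly_Ls p).[alpha, a].

Definition W0_L (n : nat) (N a : R) : inv_series n :=
  generating_series (@mu0_L n N a).

Definition W0_Ls (n : nat) (alpha a : R) : inv_series n :=
  generating_series (@mu0_Ls n alpha a).

End beta_ensemble.

(* Main.v *)
Require Import Defs.
From HB Require Import structures.
From mathcomp Require Import all_boot all_order all_algebra.
From mathcomp Require Import ring lra.
Set Implicit Arguments.
Unset Strict Implicit.
Unset Printing Implicit Defensive.
Import Order.TTheory GRing.Theory Num.Theory.
Local Open Scope ring_scope.

(** The substitution x_j -> x_j + e x_j^(k+1), at first order in e, yields for
    every k >= 0 a loop equation expressing the joint moments of power sums
    through joint moments of smaller total degree. Moments are turned into
    cumulants by taking a logarithm, which gives a quadratic recursion for the
    cumulants. After rescaling, both the low and the high temperature recursions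
    have a limit, and the limiting recursion, whose coefficients are polynomials
    in (N, a), resp. (alpha, a), determines the leading coefficients. The
    sign twist (-1)^(p_1 + ... + p_n + n - 1) N maps the second limiting
    recursion, taken at (-N, -a), to the first one. *)

(** * Shuffle products and loop equations *)

(** Cumulants are used because moments do not close up in the limit: for cumulants the pair
    interaction splits into a linear and a quadratic term, the linear one is suppressed by 1/kappa,
    resp. alpha/N, and what remains is a recursion with polynomial coefficients.

    Integration by parts is avoided. At high temperature kappa = alpha/N becomes small, so |x -
    y|^(2 kappa) is singular on the diagonal, and x^a may blow up at 0. A substitution that fixes 0
    only multiplies these factors by functions close to 1, which have expansions with remainders of
    polynomial growth.

    The leading coefficients are specified only as polynomials with prescribed limits. Hence a
    polynomial solution is constructed by running the limiting recursion over a polynomial ring, its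
    limits are verified, and uniqueness follows from a grid of integer parameter values lying in
    both parameter ranges. *)

Lemma measure_fixpoint (T U : Type) (mu : T -> nat) (Phi : (T -> U) -> T -> U)
    (f0 : T -> U) :
  (forall f g x, (forall y, (mu y < mu x)%N -> f y = g y) -> Phi f x = Phi g x) ->
  exists F, forall x, F x = Phi F x.
Proof.
(* At [x] the iterates of [Phi] stop changing once their number exceeds [mu x]; this is [stab]
   below. *)
move=> PhiP; exists (fun x => iter (mu x).+1 Phi f0 x) => x.
rewrite iterS; apply: (PhiP) => y yx.
have stab m n z : (mu z < m)%N -> (mu z < n)%N ->
    iter m Phi f0 z = iter n Phi f0 z.
  elim: m n z => [|m IH] [|n] z // zm zn; rewrite !iterS.
  by apply: (PhiP) => w wz; apply: IH; exact: leq_trans wz _.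
exact: stab.
Qed.

Lemma sumn_subseq (s t : seq nat) : subseq s t -> (sumn s <= sumn t)%N.
Proof.
elim: t s => [|y t IH] [|x s] //=; case: eqP => [-> /IH|_ /IH /= h].
  by rewrite leq_add2l.
exact: leq_trans h (leq_addl _ _).
Qed.

Section shuffle.
Variables (R : comNzRingType) (T : eqType).
Implicit Types (f g h : seq T -> R) (l : seq T).

(* A function on words is a multilinear formal power series: its value at
   [x1; ...; xn] is the coefficient of t_x1 ... t_xn. Prepending a letter is a
   partial derivative, for which the product satisfies the Leibniz rule. *)
Fixpoint shuffle f g l : R :=
  if l is x :: l' then
    shuffle (fun s => f (x :: s)) g l' + shuffle f (fun s => g (x :: s)) l'
  else f [::] * g [::].

Definition shuffle_unit l : R := (nilp l)%:R.

(** Asking for agreement only on subsequences of [l] makes inductions on the length or the sum of a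
    word possible under a shuffle product. *)
Lemma eq_shuffle f f' g g' l :
  (forall s, subseq s l -> f s = f' s) -> (forall s, subseq s l -> g s = g' s) ->
  shuffle f g l = shuffle f' g' l.
Proof.
elim: l f f' g g' => [|x l IH] f f' g g' ff' gg' /=; first by rewrite ff' ?gg'.
have sub s : subseq s l -> subseq s (x :: l).
  by move=> sl; apply: subseq_trans sl (subseq_cons _ _).
have subc s : subseq s l -> subseq (x :: s) (x :: l) by rewrite /= eqxx.
by congr (_ + _); apply: IH => s sl; (apply: ff' || apply: gg');
  (exact: sub || exact: subc).
Qed.

Lemma shuffleC f g l : shuffle f g l = shuffle g f l.
Proof.
elim: l f g => [|x l IH] f g /=; first by rewrite mulrC.
by rewrite addrC; congr (_ + _); apply: IH.
Qed.

Lemma shuffleDl f f' g l :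
  shuffle (fun s => f s + f' s) g l = shuffle f g l + shuffle f' g l.
Proof.
elim: l f f' g => [|x l IH] f f' g /=; first by rewrite mulrDl.
by rewrite !IH addrACA.
Qed.

Lemma shuffleZl (c : R) f g l :
  shuffle (fun s => c * f s) g l = c * shuffle f g l.
Proof.
elim: l f g => [|x l IH] f g /=; first by rewrite mulrA.
by rewrite !IH mulrDr.
Qed.

Lemma shuffleDr f g g' l :
  shuffle f (fun s => g s + g' s) l = shuffle f g l + shuffle f g' l.
Proof. by rewrite shuffleC shuffleDl; congr (_ + _); apply: shuffleC. Qed.

Lemma shuffleZr (c : R) f g l :
  shuffle f (fun s => c * g s) l = c * shuffle f g l.
Proof. by rewrite shuffleC shuffleZl shuffleC. Qed.

Lemma shuffle0l f g l : (forall s, subseq s l -> f s = 0) -> shuffle f g l = 0.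
Proof.
move=> f0; rewrite -[RHS](mul0r (shuffle f g l)) -shuffleZl.
by apply: eq_shuffle => // s /f0 ->; rewrite mul0r.
Qed.

Lemma shuffle_suml n (f : nat -> seq T -> R) g l :
  shuffle (fun s => \sum_(i < n) f i s) g l = \sum_(i < n) shuffle (f i) g l.
Proof.
elim: n => [|n IH].
  by rewrite big_ord0 shuffle0l// => s _; rewrite big_ord0.
rewrite big_ord_recr /= -IH -shuffleDl.
by apply: eq_shuffle => // s _; rewrite big_ord_recr.
Qed.

Lemma shuffleA f g h l :
  shuffle f (shuffle g h) l = shuffle (shuffle f g) h l.
Proof.
elim: l f g h => [|x l IH] f g h /=; first by rewrite mulrA.
by rewrite shuffleDl shuffleDr !IH addrA.
Qed.

Lemma shuffle1l f l : shuffle shuffle_unit f l = f l.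
Proof.
elim: l f => [|x l IH] f /=; first by rewrite /shuffle_unit /= mul1r.
by rewrite IH shuffle0l ?add0r.
Qed.

(** Differentiating f' f = 1 gives df' = - f' f' df, which prescribes f' on a word from its values
    on shorter words. *)
Lemma shuffle_inverse f : f [::] = 1 ->
  exists f', forall l, shuffle f' f l = shuffle_unit l.
Proof.
move=> f1.
pose Phi (F : seq T -> R) l := if l is x :: l' then
  - shuffle F (shuffle F (fun s => f (x :: s))) l' else 1.
have [|F FE] := measure_fixpoint (mu := size) (Phi := Phi) (fun=> 0).
  move=> F G [|x l] // FG; congr (- _).
  apply: eq_shuffle => s /size_subseq sl; first exact: FG.
  apply: eq_shuffle => t /size_subseq st //.
  by apply: FG; rewrite ltnS (leq_trans st).
exists F => l; elim: {l}(size l) {-2}l (leqnn (size l)) => [|n IH] [|x l] //=.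
- by rewrite f1 FE mulr1.
- by rewrite f1 FE mulr1.
rewrite ltnS => ln; rewrite /shuffle_unit /=.
have -> : shuffle (fun s => F (x :: s)) f l =
    - shuffle F (fun s => f (x :: s)) l.
  have -> : shuffle (fun s => F (x :: s)) f l =
     shuffle (fun s => -1 * shuffle F (shuffle F (fun s => f (x :: s))) s) f l.
    by apply: eq_shuffle => // s _; rewrite FE mulN1r.
  rewrite shuffleZl mulN1r; congr (- _).
  (* Moving [f] next to the outer [F] produces their product, which is the unit on shorter words by
     induction. *)
  rewrite shuffleC shuffleA shuffleC.
  transitivity (shuffle (shuffle F (fun s => f (x :: s))) shuffle_unit l).
    apply: eq_shuffle => // s /size_subseq sl; rewrite shuffleC IH //.
    exact: leq_trans sl ln.
  by rewrite shuffleC shuffle1l.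
by rewrite addNr.
Qed.

(** A series with constant term 1 is invertible, hence not a zero divisor. *)
Lemma shuffle_cancel f g l : g [::] = 1 ->
  (forall s, subseq s l -> shuffle f g s = 0) -> f l = 0.
Proof.
move=> g1 fg0; have [g' g'g] := shuffle_inverse g1.
rewrite -[RHS](@shuffle0l (shuffle f g) g' l)// -shuffleA shuffleC.
rewrite -[LHS]shuffle1l; apply: eq_shuffle => // s _.
by rewrite shuffleC g'g.
Qed.

End shuffle.

Lemma shuffle_rmorph (R S : comNzRingType) (T : eqType) (phi : {rmorphism R -> S})
    (f g : seq T -> R) l :
  phi (shuffle f g l) = shuffle (phi \o f) (phi \o g) l.
Proof.
elim: l f g => [|x l IH] f g /=; first by rewrite rmorphM.
by rewrite rmorphD !IH.
Qed.

(** * Loop equations for moments and cumulants, and their rescaling *)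

Section loop_equations.
Variable R : comNzRingType.
Implicit Types (f g M K : seq nat -> R) (l : seq nat).

(* The derivative of a product of power sums along the vector field
   x^(k+1) d/dx, which maps x^p to p x^(p+k). *)
Fixpoint shift_sum k f l : R :=
  if l is x :: l' then
    x%:R * f ((k + x)%N :: l') + shift_sum k (fun s => f (x :: s)) l'
  else 0.

(** The side conditions describe the words at which [f] is evaluated, as the inductions on the sum
    of a word require. *)
Lemma eq_shift_sum k f f' l :
  (forall s, (0 < size s)%N -> size s = size l -> sumn s = (k + sumn l)%N ->
     f s = f' s) ->
  shift_sum k f l = shift_sum k f' l.
Proof.
elim: l f f' => [//|x l IH] f f' ff' /=.
rewrite ff' /= ?addnA//; congr (_ + _); apply: IH => s _ ss sl.
by apply: ff'; rewrite /= ?ss// sl addnCA.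
Qed.

Lemma shift_sumD k f g l :
  shift_sum k (fun s => f s + g s) l = shift_sum k f l + shift_sum k g l.
Proof.
elim: l f g => [|x l IH] f g /=; first by rewrite addr0.
by rewrite IH mulrDr addrACA.
Qed.

Lemma shift_sumZ k (c : R) f l :
  shift_sum k (fun s => c * f s) l = c * shift_sum k f l.
Proof.
elim: l f => [|x l IH] f /=; first by rewrite mulr0.
by rewrite IH mulrDr mulrCA.
Qed.

(** On series, [shift_sum k] is the first-order operator summing p t_p d/dt_(p+k) over p, hence a
    derivation. *)
Lemma shift_sum_shuffle k f g l :
  shift_sum k (shuffle f g) l =
  shuffle (shift_sum k f) g l + shuffle f (shift_sum k g) l.
Proof.
elim: l f g => [|x l IH] f g /=; first by rewrite mul0r mulr0 addr0.
rewrite shift_sumD !IH shuffleDl shuffleDr shuffleZl shuffleZr mulrDr.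
ring.
Qed.

(** Virasoro constraints, solved for the moment of highest degree. [n] is the number of particles,
    that is the power sum of exponent 0; [b] weighs the pair interaction and [c] the transport of
    the other power sums. *)
Definition moment_loop (A : nat -> R) (b c n : R) M :=
  (forall l, M (0%N :: l) = n * M l) /\
  (forall k l, M (k.+1 :: l) = A k * M (k :: l)
     + b * (\sum_(s < k.+1) M [:: val s, (k - s)%N & l]) + c * shift_sum k M l).

(** A second derivative of exp K is (ddK + dK dK) exp K, so the interaction splits in two. The
    coefficients [b1] and [b2] start out equal but rescale differently, and only [b2] survives in
    the limits. *)
Definition cumulant_loop (A : nat -> R) (b1 b2 c n : R) K :=
  (forall l, K (0%N :: l) = n * shuffle_unit R l) /\
  (forall k l, K (k.+1 :: l) = A k * K (k :: l)
     + b1 * (\sum_(s < k.+1) K [:: val s, (k - s)%N & l])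
     + b2 * (\sum_(s < k.+1)
         shuffle (fun t => K (val s :: t)) (fun t => K ((k - s)%N :: t)) l)
     + c * shift_sum k K l).

(* M = exp K for the shuffle product *)
Definition cumulants_of M K :=
  forall x l, M (x :: l) = shuffle (fun s => K (x :: s)) M l.

(** On nonempty words [K] is read off the logarithmic derivative dM / M; the value at the empty word
    is set to 0. *)
Lemma cumulants_ofE M : M [::] = 1 -> exists K, cumulants_of M K.
Proof.
move=> M1; have [M' M'M] := shuffle_inverse M1.
exists (fun l => if l is x :: l' then shuffle M' (fun s => M (x :: s)) l' else 0).
move=> x l /=; rewrite shuffleC shuffleA.
rewrite (@eq_shuffle _ _ _ (@shuffle_unit R _) _ (fun s => M (x :: s)))//.
  by rewrite shuffle1l.
by move=> s _; rewrite shuffleC M'M.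
Qed.

(** The chain rule D(exp K) = (D K) exp K for the derivation [shift_sum k]. *)
Lemma shift_sum_cumulant M K k l : cumulants_of M K ->
  shift_sum k M l = shuffle (shift_sum k K) M l.
Proof.
move=> MK; elim: {l}(size l) {-2}l (leqnn (size l)) => [|n IH] [|x l] //=;
  rewrite ?mul0r// ltnS => ln.
have -> : shift_sum k (fun s => M (x :: s)) l =
    shift_sum k (shuffle (fun s => K (x :: s)) M) l.
  by apply: eq_shift_sum => s _ _ _; exact: MK.
rewrite MK shift_sum_shuffle shuffleDl shuffleZl addrA; congr (_ + _).
rewrite (@eq_shuffle _ _ _ (fun s => K (x :: s)) (shift_sum k M)
          (shuffle (shift_sum k K) M))//; last first.
  by move=> s /size_subseq sl; apply: IH; exact: leq_trans sl ln.
rewrite (@eq_shuffle _ _ (shift_sum k K) (shift_sum k K) (fun s => M (x :: s))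
          (shuffle (fun s => K (x :: s)) M))//.
rewrite shuffleA shuffleC [RHS]shuffleA [RHS]shuffleC; apply: eq_shuffle => // s _.
exact: shuffleC.
Qed.

(** The defect of each cumulant equation, multiplied by M, is the defect of the corresponding moment
    equation, which is zero; then M is cancelled. *)
Lemma moment_cumulant_loop A b c n M K : M [::] = 1 -> cumulants_of M K ->
  moment_loop A b c n M -> cumulant_loop A b b c n K.
Proof.
move=> M1 MK [M0 MS]; split.
  move=> l; apply/eqP; rewrite -subr_eq0; apply/eqP; move: l.
  pose d l := K (0%N :: l) - n * shuffle_unit R l.
  move=> l; apply: (@shuffle_cancel _ _ d M) => // s _; rewrite /d.
  transitivity (M (0%N :: s) - n * M s); last by rewrite M0 subrr.
  rewrite MK -[X in n * X]shuffle1l -mulNr -shuffleZl -shuffleDl.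
  by apply: eq_shuffle => // t _; rewrite mulNr.
move=> k l; apply/eqP; rewrite -subr_eq0; apply/eqP.
pose d l := K (k.+1 :: l) - (A k * K (k :: l)
     + b * (\sum_(s < k.+1) K [:: val s, (k - s)%N & l])
     + b * (\sum_(s < k.+1)
         shuffle (fun t => K (val s :: t)) (fun t => K ((k - s)%N :: t)) l)
     + c * shift_sum k K l).
apply: (@shuffle_cancel _ _ d M) => // {}l _; rewrite /d.
transitivity (M (k.+1 :: l) - (A k * M (k :: l)
     + b * (\sum_(s < k.+1) M [:: val s, (k - s)%N & l]) + c * shift_sum k M l));
  last by rewrite -MS subrr.
have M2 s t : M [:: s, t & l] = shuffle (fun r => K [:: s, t & r]) M l +
    shuffle (shuffle (fun r => K (s :: r)) (fun r => K (t :: r))) M l.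
  rewrite MK /= -shuffleA; congr (_ + _).
  by apply: eq_shuffle => // r _; exact: MK.
under [in RHS]eq_bigr do rewrite M2.
rewrite big_split /= !MK (shift_sum_cumulant _ _ MK).
rewrite -(shuffle_suml k.+1 (fun s r => K [:: s, (k - s)%N & r])).
rewrite -(shuffle_suml k.+1 (fun s => shuffle (fun t => K (s :: t))
  (fun t => K ((k - s)%N :: t)))).
rewrite mulrDr addrA -!shuffleZl -!shuffleDl -mulN1r -shuffleZl -shuffleDl.
by apply: eq_shuffle => // r _; rewrite mulN1r.
Qed.

(** A weight for the gradings of words by length and by sum. Shuffling distributes the letters over
    two words, so the weight is multiplicative. *)
Definition bigrading (mu nu : R) l : R := mu ^+ size l * nu ^+ sumn l.

Lemma bigrading_cons mu nu x l :
  bigrading mu nu (x :: l) = mu * nu ^+ x * bigrading mu nu l.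
Proof. by rewrite /bigrading /= exprS exprD; ring. Qed.

Lemma shuffle_bigrading mu nu f g l :
  shuffle (fun t => bigrading mu nu t * f t) (fun t => bigrading mu nu t * g t) l =
  bigrading mu nu l * shuffle f g l.
Proof.
elim: l f g => [|x l IH] f g /=; first by rewrite /bigrading /=; ring.
rewrite bigrading_cons mulrDr -!(mulrA (mu * nu ^+ x)) -!IH -shuffleZl -shuffleZr.
by congr (_ + _); apply: eq_shuffle => // s _; rewrite bigrading_cons mulrA.
Qed.

Lemma shift_sum_bigrading mu nu k f l :
  shift_sum k (fun t => bigrading mu nu t * f t) l =
  nu ^+ k * bigrading mu nu l * shift_sum k f l.
Proof.
elim: l f => [|x l IH] f /=; first by rewrite mulr0.
rewrite !bigrading_cons exprD mulrDr; congr (_ + _); first by ring.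
rewrite [RHS](_ : _ = mu * nu ^+ x *
    (nu ^+ k * bigrading mu nu l * shift_sum k (fun s => f (x :: s)) l)); last ring.
rewrite -IH -shift_sumZ; apply: eq_shift_sum => s _ _ _.
by rewrite bigrading_cons mulrA.
Qed.

(** Compared with the left-hand side, the [A], [b1] and [b2] terms have sum one less (factor [nu]),
    the latter two have one more letter (factor [mu]), and the quadratic term has one more [la]. The
    conditions are free of division, so that [la] may vanish. *)
Lemma cumulant_loop_scale A A' b1 b1' b2 b2' c c' n n' (la mu nu : R) K :
  (forall k, A' k = nu * A k) -> b1' * mu = nu * b1 -> b2' * (la * mu) = nu * b2 ->
  c' = mu * nu * c -> n' = la * mu * n ->
  cumulant_loop A b1 b2 c n K ->
  cumulant_loop A' b1' b2' c' n' (fun l => la * (bigrading mu nu l * K l)).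
Proof.
move=> AE b1E b2E cE nE [K0 KS]; split=> [l|k l].
  rewrite bigrading_cons K0 nE /shuffle_unit; case: l => [|x l] /=; last by rewrite !mulr0.
  by rewrite /bigrading /= !expr0; ring.
set w := bigrading mu nu l.
rewrite !bigrading_cons KS AE cE -/w.
have -> : \sum_(s < k.+1) la * (bigrading mu nu [:: val s, (k - s)%N & l] *
      K [:: val s, (k - s)%N & l]) =
    la * (mu ^+ 2 * nu ^+ k * w) * \sum_(s < k.+1) K [:: val s, (k - s)%N & l].
  rewrite big_distrr /=; apply: eq_bigr => s _.
  have kE : nu ^+ k = nu ^+ s * nu ^+ (k - s) by rewrite -exprD subnKC// -ltnS.
  by rewrite !bigrading_cons kE -/w /=; ring.
have -> : \sum_(s < k.+1) shuffle
      (fun t => la * (bigrading mu nu (val s :: t) * K (val s :: t)))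
      (fun t => la * (bigrading mu nu ((k - s)%N :: t) * K ((k - s)%N :: t))) l =
    la ^+ 2 * (mu ^+ 2 * nu ^+ k * w) * \sum_(s < k.+1)
      shuffle (fun t => K (val s :: t)) (fun t => K ((k - s)%N :: t)) l.
  rewrite big_distrr /=; apply: eq_bigr => s _.
  have kE : nu ^+ k = nu ^+ s * nu ^+ (k - s) by rewrite -exprD subnKC// -ltnS.
  rewrite !shuffleZl !shuffleZr /=.
  rewrite (@eq_shuffle _ _ _ (fun t => mu * nu ^+ s *
      (bigrading mu nu t * K (val s :: t))) _ (fun t => mu * nu ^+ (k - s) *
      (bigrading mu nu t * K ((k - s)%N :: t)))); last 2 first.
  - by move=> t _; rewrite bigrading_cons; ring.
  - by move=> t _; rewrite bigrading_cons; ring.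
  by rewrite shuffleZl shuffleZr shuffle_bigrading -/w kE /=; ring.
rewrite shift_sumZ shift_sum_bigrading -/w exprS.
rewrite [b1' * _](_ : _ = b1' * mu * (la * (mu * nu ^+ k * w)) *
  \sum_(s < k.+1) K [:: val s, (k - s)%N & l]); last ring.
rewrite [b2' * _](_ : _ = b2' * (la * mu) * (la * (mu * nu ^+ k * w)) *
  \sum_(s < k.+1)
      shuffle (fun t => K (val s :: t)) (fun t => K ((k - s)%N :: t)) l); last ring.
rewrite b1E b2E; ring.
Qed.

(** Every word on the right-hand side has a smaller sum, so the equations are a recursive
    definition. Over [{poly {poly R}}] this is the source of polynomiality in the parameters. *)
Lemma cumulant_loop_exists A b2 n : exists K, cumulant_loop A 0 b2 1 n K.
Proof.
pose Phi (F : seq nat -> R) l : R := match l with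
  | [::] => 0
  | 0%N :: l => n * shuffle_unit R l
  | k.+1 :: l => A k * F (k :: l)
     + b2 * (\sum_(s < k.+1)
         shuffle (fun t => F (val s :: t)) (fun t => F ((k - s)%N :: t)) l)
     + shift_sum k F l end.
have [|K KE] := measure_fixpoint (mu := sumn) (Phi := Phi) (fun=> 0).
  move=> f g [|[|k] l] //= fg; rewrite fg /= ?addSn//; congr (_ + _ * _ + _).
    apply: eq_bigr => s _; apply: eq_shuffle => t /sumn_subseq tl.
      by apply: fg; rewrite /= ltnS leq_add//; exact: (ltn_ord s).
    by apply: fg; rewrite /= ltnS leq_add// leq_subr.
  by apply: eq_shift_sum => s _ _ sE; apply: fg; rewrite sE.
exists K; split=> [l|k l]; rewrite KE //=; ring.
Qed.

(** The same descent on the sum. The empty word is left out because no equation involves its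
    cumulant. *)
Lemma cumulant_loop_unique A b1 b2 c n K K' :
  cumulant_loop A b1 b2 c n K -> cumulant_loop A b1 b2 c n K' ->
  forall x l, K (x :: l) = K' (x :: l).
Proof.
move=> [K0 KS] [K'0 K'S] x l.
suff H d l' : (sumn l' < d)%N -> (0 < size l')%N -> K l' = K' l'.
  exact: H (ltnSn _) _.
elim: d l' => [//|d IH] [|[|k] {}l]; rewrite ?ltnn// => ld _; first by rewrite K0 K'0.
rewrite /= ltnS in ld.
rewrite KS K'S IH//; congr (_ * _ + _ * _ + _ * _ + _ * _).
- apply: eq_bigr => s _; apply: IH => //=.
  by rewrite addnA subnKC// -ltnS.
- apply: eq_bigr => s _; apply: eq_shuffle => t /sumn_subseq tl; apply: IH => //=.
    by rewrite (leq_ltn_trans _ ld)// leq_add// -ltnS.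
  by rewrite (leq_ltn_trans _ ld)// leq_add// leq_subr.
- by apply: eq_shift_sum => s s0 _ sE; apply: IH => //; rewrite sE.
Qed.

End loop_equations.

Lemma cumulant_loop_rmorph (R S : comNzRingType) (phi : {rmorphism R -> S})
    (A : nat -> R) b1 b2 c n K :
  cumulant_loop A b1 b2 c n K ->
  cumulant_loop (phi \o A) (phi b1) (phi b2) (phi c) (phi n) (phi \o K).
Proof.
move=> [K0 KS]; split=> [l|k l] /=.
  by rewrite K0 rmorphM /shuffle_unit rmorph_nat.
rewrite KS !rmorphD !rmorphM !rmorph_sum; congr (_ + _ + _ * _ + _ * _).
  by apply: eq_bigr => s _; rewrite shuffle_rmorph.
by elim: l K {K0 KS} => [|x l IH] K /=; rewrite ?rmorph0// rmorphD rmorphM rmorph_nat IH.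
Qed.

(** * Cumulants as sums over set partitions *)

Section partition_cumulant.
Variables (R : comNzRingType) (I : finType) (m : {set I} -> R).

Definition partition_cumulant (S : {set I}) : R :=
  \sum_(P : {set {set I}} | partition P S)
     (-1) ^+ (#|P|.-1) * (#|P|.-1)`!%:R * \prod_(B in P) m B.

(** For [q] > 0 blocks, the Möbius function of the partition lattice between a partition and the
    one-block partition. *)
Let c q : R := (-1) ^+ (q.-1) * (q.-1)`!%:R.

Lemma partition_blockC (S B : {set I}) (F : {set {set I}} -> R) :
  B != set0 -> B \subset S ->
  \sum_(P | partition P (S :\: B)) F (B |: P) =
  \sum_(Q | partition Q S && (B \in Q)) F Q.
Proof.
move=> B0 BS; rewrite [RHS](reindex_onto (fun P => B |: P) (fun Q => Q :\ B)) /=;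
  last by move=> Q /andP[_ BQ]; rewrite setD1K.
apply: eq_bigl => P; apply/idP/idP => [pP|].
  have BP : B \notin P.
    apply/negP => BP; have /subsetP := partitionS pP BP.
    have /set0Pn[x xB] := B0.
    by move=> /(_ _ xB); rewrite inE xB.
  rewrite setU1K// eqxx andbT setU11 andbT.
  rewrite -(setID S B) (setIidPr BS); apply: partitionU1 => //.
  by rewrite disjoint_sym disjoints_subset subsetDr.
move=> /andP[/andP[pQ BQ] /eqP PE].
by rewrite -[P]PE; exact: partitionD1.
Qed.

(* In the sum over J and over the partitions P of J, a partition Q of S arises
   from J = S once, and from P = Q minus a block avoiding i in #|Q| - 1 ways;
   the two contributions cancel unless Q = {S}. *)
Lemma partition_cumulant_rec (S : {set I}) i : m set0 = 1 -> i \in S ->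
  m S = \sum_(J : {set I} | (i \in J) && (J \subset S))
          partition_cumulant J * m (S :\: J).
Proof.
move=> m0 iS; rewrite (bigD1 S) /=; last by rewrite iS subxx.
rewrite setDv m0 mulr1.
have -> : \sum_(J : {set I} | (i \in J) && (J \subset S) && (J != S))
      partition_cumulant J * m (S :\: J) =
    \sum_(Q | partition Q S) (#|Q|.-1)%:R * c #|Q|.-1 * \prod_(B in Q) m B.
  (* The complement B of J is to become an additional block, one that avoids [i]. *)
  rewrite (reindex_onto (fun B => S :\: B) (fun J => S :\: J)) /=; last first.
    move=> J /andP[/andP[_ JS] _]; by rewrite setDDr setDv set0U (setIidPr JS).
  under eq_bigl => B.
    rewrite (_ : _ && _ = [&& B \subset S, i \notin B & B != set0]); last first.
      rewrite inE iS subsetDl !andbT -andbA [RHS]andbC -andbA; congr andb.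
      rewrite setDDr setDv set0U.
      have [BS|BS] := boolP (B \subset S); last first.
        rewrite andbF; apply/negbTE; rewrite negb_and; apply/orP; right.
        by apply: contra BS => /eqP <-; exact: subsetIl.
      rewrite (setIidPr BS) eqxx !andbT; congr negb; apply/eqP/eqP => [|->].
        move=> h; apply/eqP; rewrite -subset0; apply/subsetP => x xB.
        by have := subsetP BS x xB; rewrite -h inE xB.
      by rewrite setD0.
    over.
  transitivity (\sum_(B : {set I} | [&& B \subset S, i \notin B & B != set0])
      \sum_(Q | partition Q S && (B \in Q)) c #|Q|.-1 * \prod_(D in Q) m D).
    apply: eq_bigr => B /and3P[BS iB B0].
    rewrite -(@partition_blockC S B (fun Q => c #|Q|.-1 * \prod_(D in Q) m D))//.
    rewrite mulr_suml; apply: eq_bigr => P pP.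
    have BP : B \notin P.
      apply/negP => BP; have /subsetP := partitionS pP BP.
      have /set0Pn[x xB] := B0.
      by move=> /(_ _ xB); rewrite inE xB.
    rewrite cardsU1 BP add1n /= big_setU1//= setDDr setDv set0U (setIidPr BS).
    by rewrite -[LHS]mulrA; congr (_ * _); exact: mulrC.
  rewrite (exchange_big_dep (fun Q => partition Q S)) /=; last by move=> B Q _ /andP[].
  apply: eq_bigr => Q pQ; rewrite sumr_const -[LHS]mulr_natl -[RHS]mulrA; congr (_%:R * _).
  have trQ := partition_trivIset pQ.
  have iQ : i \in cover Q by rewrite (cover_partition pQ).
  (* The blocks avoiding [i] are all blocks but one, [pblock Q i]. *)
  have := cardsD1 (pblock Q i) Q; rewrite pblock_mem// add1n => -> /=.
  apply: eq_card => B; rewrite !inE pQ /= unfold_in.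
  have [BQ|] := boolP (B \in Q); last by rewrite !andbF.
  rewrite (partitionS pQ BQ) (partition_neq0 pQ BQ) !andbT /=; congr negb.
  apply/idP/eqP => [iB|->]; first by rewrite (def_pblock trQ BQ iB).
  by rewrite mem_pblock.
rewrite -big_split /= (bigD1 [set S]) /=; last first.
  rewrite /partition /cover big_set1 eqxx inE eq_sym /=.
  rewrite (_ : S == set0 = false) ?andbT; last by apply/eqP => S0; rewrite S0 inE in iS.
  by apply/trivIsetP => A B /set1P -> /set1P ->; rewrite eqxx.
rewrite [X in _ + X]big1 => [|Q /andP[pQ QS]].
  by rewrite cards1 big_set1 /= !mul0r !addr0 !mul1r.
rewrite -mulrDl.
have : #|Q| != 1%N.
  apply: contra QS => /cards1P[B QB]; apply/eqP; rewrite QB.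
  by have := cover_partition pQ; rewrite QB /cover big_set1 => ->.
have : (0 < #|Q|)%N.
  rewrite lt0n cards_eq0; apply/eqP => Q0; have := cover_partition pQ.
  by rewrite Q0 /cover big_set0 => S0; rewrite -S0 inE in iS.
(* With q + 2 blocks the two coefficients are (-1)^(q+1) (q+1)! and (q+1) (-1)^q q!. *)
case: #|Q| => [//|[//|q]] _ _; by rewrite /c /= factS natrM exprS mulN1r mulNr mulrCA addNr mul0r.
Qed.

End partition_cumulant.

Lemma shuffle_map (R : comNzRingType) (T U : eqType) (p : T -> U)
    (f g : seq U -> R) l :
  shuffle f g (map p l) = shuffle (f \o map p) (g \o map p) l.
Proof. by elim: l f g => [|x l IH] f g //=; rewrite !IH. Qed.

Lemma subsetU1N (I : finType) (x : I) (J S : {set I}) : x \notin S ->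
  (J \subset S) = (J \subset x |: S) && (x \notin J).
Proof.
move=> xS; apply/idP/andP => [JS|[/subsetP JS xJ]].
  split; first exact: subset_trans JS (subsetU1 _ _).
  by apply: contra xS; exact: (subsetP JS).
apply/subsetP => y yJ; have := JS y yJ; rewrite !inE => /orP[/eqP yx|//].
by rewrite -yx yJ in xJ.
Qed.

(** Links series on words to set-indexed moments: each letter goes to one of the two factors, and
    without repetitions such a splitting is a subset. *)
Lemma shuffle_subsets (R : comNzRingType) (I : finType) (f g : seq I -> R) l :
  uniq l ->
  shuffle f g l = \sum_(J : {set I} | J \subset [set x in l])
    f [seq x <- l | x \in J] * g [seq x <- l | x \notin J].
Proof.
elim: l f g => [|x l IH] f g /=.
  move=> _; rewrite (big_pred1 set0)//= => J.
  by rewrite set_nil subset0.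
move=> /andP[xl ul]; rewrite !IH// addrC [RHS](bigID (fun J : {set I} => x \notin J)) /=.
congr (_ + _).
  apply: eq_big => [J|J JS].
    by rewrite set_cons; apply: subsetU1N; rewrite inE.
  have xJ : x \notin J by apply: contra xl => /(subsetP JS); rewrite inE.
  by rewrite xJ (negbTE xJ).
rewrite [RHS](reindex_onto (fun J => x |: J) (fun J => J :\ x)) /=; last first.
  by move=> J /andP[_]; rewrite negbK => xJ; rewrite setD1K.
apply: eq_big => [J|J JS].
  rewrite set_cons setU11 /= andbT.
  apply/idP/andP => [JS|[/subsetP JS /eqP <-]].
    split; first exact: setUS.
    rewrite setU1K//; apply: contra xl => /(subsetP JS); by rewrite inE.
  apply/subsetP => y; rewrite !inE => /andP[yx]; rewrite (negbTE yx) /= => yJ.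
  have := JS y; rewrite !inE (negbTE yx) /= yJ; exact.
rewrite setU11; congr (f (_ :: _) * g _).
  by apply: eq_in_filter => y yl; rewrite !inE; case: eqP => // yx; rewrite -yx yl in xl.
by apply: eq_in_filter => y yl; rewrite !inE; case: eqP => // yx; rewrite -yx yl in xl.
Qed.

(** Both cumulants solve the same linear recursion over the moments, so their difference times M
    vanishes and M cancels. Words of indices, sent to exponents by [p], keep positions with equal
    exponents apart. *)
Lemma partition_cumulantE (R : comNzRingType) (I : finType) (m : {set I} -> R)
    (p : I -> nat) (M K : seq nat -> R) :
  M [::] = 1 -> cumulants_of M K ->
  (forall s, uniq s -> M (map p s) = m [set x in s]) ->
  forall x l, uniq (x :: l) ->
    partition_cumulant m [set y in x :: l] = K (map p (x :: l)).
Proof.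
move=> M1 MK Mm x l uxl; apply/eqP; rewrite -subr_eq0; apply/eqP.
pose d s := partition_cumulant m [set y in x :: s] - K (map p (x :: s)).
apply: (@shuffle_cancel _ _ d (M \o map p)) => //= s sl.
have uxs : uniq (x :: s) by apply: subseq_uniq uxl; rewrite /= eqxx.
transitivity (shuffle (fun s => partition_cumulant m [set y in x :: s])
   (M \o map p) s - shuffle (fun s => K (map p (x :: s))) (M \o map p) s).
  rewrite -mulN1r -shuffleZl -shuffleDl; apply: eq_shuffle => // t _.
  by rewrite mulN1r.
have -> : shuffle (fun s => K (map p (x :: s))) (M \o map p) s = M (map p (x :: s)).
  by rewrite /= MK shuffle_map.
have /andP[xs us] := uxs.
rewrite Mm// shuffle_subsets//.
rewrite (@partition_cumulant_rec _ _ m [set y in x :: s] x); last 2 first.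
- by rewrite -M1 (Mm [::])// set_nil.
- by rewrite inE mem_head.
apply/eqP; rewrite subr_eq0; apply/eqP.
rewrite [RHS](reindex_onto (fun J => x |: J) (fun J => J :\ x)) /=; last first.
  by move=> J /andP[xJ _]; rewrite setD1K.
apply: eq_big => [J|J JS].
  rewrite setU11 set_cons /=; apply/idP/andP => [JS|[/subsetP JS /eqP <-]].
    split; first exact: setUS.
    rewrite setU1K//; apply: contra xs => /(subsetP JS); by rewrite inE.
  apply/subsetP => y; rewrite !inE => /andP[yx]; rewrite (negbTE yx) /= => yJ.
  have := JS y; rewrite !inE (negbTE yx) /= yJ; exact.
have xJ : x \notin J by apply: contra xs => /(subsetP JS); rewrite inE.
rewrite /= Mm ?filter_uniq//; congr (partition_cumulant m _ * m _).
  apply/setP => y; rewrite !inE mem_filter; case: eqP => //= yx.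
  apply/andP/idP => [[]//|yJ]; split=> //.
  by have := subsetP JS y yJ; rewrite inE.
apply/setP => y; rewrite !inE mem_filter; case: eqP => //= ->.
by rewrite (negbTE xs) andbF.
Qed.

From mathcomp Require Import all_classical all_reals all_analysis.
From mathcomp Require Import measurable_realfun.
From mathcomp Require Import zify.
Import numFieldNormedType.Exports.
Local Open Scope classical_set_scope.
Local Open Scope ring_scope.

(** * Limits of solutions of the loop equations *)

Section cumulant_limit.
Context {R : realType} {T : Type} (F : set_system T) {FF : Filter F}.

Lemma cvg_shuffle (U : eqType) (f g : T -> seq U -> R) (f0 g0 : seq U -> R) l :
  (forall s, subseq s l -> f t s @[t --> F] --> f0 s) ->
  (forall s, subseq s l -> g t s @[t --> F] --> g0 s) ->
  shuffle (f t) (g t) l @[t --> F] --> shuffle f0 g0 l.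
Proof.
elim: l f g f0 g0 => [|x l IH] f g f0 g0 /= ff0 gg0.
  by apply: cvgM; [exact: ff0|exact: gg0].
have sub s : subseq s l -> subseq s (x :: l).
  by move=> sl; apply: subseq_trans sl (subseq_cons _ _).
have subc s : subseq s l -> subseq (x :: s) (x :: l) by rewrite /= eqxx.
apply: cvgD.
  by apply: (IH (fun t s => f t (x :: s)) g (fun s => f0 (x :: s)) g0) => s sl;
    [apply: ff0; exact: subc|apply: gg0; exact: sub].
by apply: (IH f (fun t s => g t (x :: s)) f0 (fun s => g0 (x :: s))) => s sl;
  [apply: ff0; exact: sub|apply: gg0; exact: subc].
Qed.

Lemma cvg_shift_sum k (f : T -> seq nat -> R) (f0 : seq nat -> R) l :
  (forall s, (0 < size s)%N -> sumn s = (k + sumn l)%N ->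
     f t s @[t --> F] --> f0 s) ->
  shift_sum k (f t) l @[t --> F] --> shift_sum k f0 l.
Proof.
elim: l f f0 => [|x l IH] f f0 /= ff0; first exact: cvg_cst.
apply: cvgD; first by apply: cvgM; [exact: cvg_cst|apply: ff0; rewrite //= addnA].
apply: (IH (fun t s => f t (x :: s)) (fun s => f0 (x :: s))) => s _ sE.
by apply: ff0; rewrite //= sE addnCA.
Qed.

(** By induction on the sum, the value at a word is a fixed polynomial in the coefficients and in
    values at words of smaller sum. The equations are only asked for eventually, since they hold for
    kappa > 0, resp. N > 0. *)
Lemma cumulant_loop_cvg (A : T -> nat -> R) (b1 b2 c n : T -> R)
    (K : T -> seq nat -> R) (A0 : nat -> R) (b10 b20 c0 n0 : R)
    (K0 : seq nat -> R) :
  (\forall t \near F, cumulant_loop (A t) (b1 t) (b2 t) (c t) (n t) (K t)) ->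
  (forall k, A t k @[t --> F] --> A0 k) ->
  b1 @ F --> b10 -> b2 @ F --> b20 -> c @ F --> c0 -> n @ F --> n0 ->
  cumulant_loop A0 b10 b20 c0 n0 K0 ->
  forall x l, K t (x :: l) @[t --> F] --> K0 (x :: l).
Proof.
move=> nK cA cb1 cb2 cc cn [K00 K0S] x l.
suff H d s : (sumn s < d)%N -> (0 < size s)%N -> K t s @[t --> F] --> K0 s.
  exact: H (ltnSn _) _.
elim: d s => [//|d IH] [|[|k] {}l]; rewrite ?ltnn// => ld _.
  rewrite K00.
  have E : {near F, (fun t => n t * shuffle_unit R l) =1 (fun t => K t (0%N :: l))}.
    by apply: filterS nK => t [-> _].
  by apply: cvg_trans (near_eq_cvg E) _; apply: cvgM; [exact: cn|exact: cvg_cst].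
rewrite /= ltnS in ld.
have E : {near F, (fun t => A t k * K t (k :: l)
     + b1 t * (\sum_(s < k.+1) K t [:: val s, (k - s)%N & l])
     + b2 t * (\sum_(s < k.+1)
         shuffle (fun u => K t (val s :: u)) (fun u => K t ((k - s)%N :: u)) l)
     + c t * shift_sum k (K t) l) =1 (fun t => K t (k.+1 :: l))}.
  by apply: filterS nK => t [_ ->].
rewrite K0S; apply: cvg_trans (near_eq_cvg E) _.
apply: cvgD.
  apply: cvgD.
    apply: cvgD.
      by apply: cvgM; [exact: cA|apply: IH].
    apply: cvgM; first exact: cb1.
    apply: (@cvg_big _ _ _ _ _ add_continuous _ _ _ (fun (s : 'I_k.+1) t =>
      K t [:: val s, (k - s)%N & l])) => s _.
    by apply: IH => //=; rewrite addnA subnKC// -ltnS.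
  apply: cvgM; first exact: cb2.
  apply: (@cvg_big _ _ _ _ _ add_continuous _ _ _ (fun (s : 'I_k.+1) t =>
    shuffle (fun u => K t (val s :: u)) (fun u => K t ((k - s)%N :: u)) l)) => s _.
  apply: (@cvg_shuffle _ (fun t u => K t (val s :: u))
    (fun t u => K t ((k - s)%N :: u))) => u /sumn_subseq tl; apply: IH => //=.
    by rewrite (leq_ltn_trans _ ld)// leq_add// -ltnS.
  by rewrite (leq_ltn_trans _ ld)// leq_add// leq_subr.
apply: cvgM; first exact: cc.
by apply: cvg_shift_sum => s s0 sE; apply: IH => //; rewrite sE.
Qed.

End cumulant_limit.

(** * Substitution on the positive half-line and on the orthant *)

Section substitution.
Context {R : realType}.
Local Notation leb := (@lebesgue_measure R).
Variables (phi phi' : R -> R).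
Hypothesis dphi : forall x, is_derive x (1 : R) phi (phi' x).
Hypothesis cphi' : continuous phi'.
Hypothesis phi'_ge0 : forall x, 0 <= x -> 0 <= phi' x.
Hypothesis phi0 : phi 0 = 0.
Hypothesis phi_lt : forall x y, 0 <= x -> x < y -> phi x < phi y.
Hypothesis phi_surj : forall y, 0 <= y -> exists2 x, 0 <= x & phi x = y.

Let pos : set (measurableTypeR R) := [set x | 0 < x].

Let mpos : measurable pos.
Proof.
rewrite (_ : pos = `]0, +oo[%classic); first exact: measurable_itv.
by apply/seteqP; split => x /=; rewrite in_itv/= andbT.
Qed.

Let cphi : continuous phi.
Proof. by move=> x; apply/differentiable_continuous/derivable1_diffP; exact: ex_derive. Qed.

Let mphi : measurable_fun setT (phi : measurableTypeR R -> measurableTypeR R).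
Proof. exact: continuous_measurable_fun. Qed.

Let mphi' : measurable_fun setT (phi' : measurableTypeR R -> measurableTypeR R).
Proof. exact: continuous_measurable_fun. Qed.

Let mpre (A : set (measurableTypeR R)) : measurable A -> measurable (pos `&` phi @^-1` A).
Proof.
move=> mA; apply: measurableI => //; rewrite -[X in measurable X]setTI.
exact: mphi.
Qed.

Let phi_le x y : 0 <= x -> 0 <= y -> (phi x <= phi y) = (x <= y).
Proof.
move=> x0 y0; case: (leP x y) => [|yx]; last by apply/negbTE; rewrite -ltNge phi_lt.
by rewrite le_eqVlt => /orP[/eqP ->|xy]; [rewrite lexx|rewrite ltW// phi_lt].
Qed.

Let phi_ltE x y : 0 <= x -> 0 <= y -> (phi x < phi y) = (x < y).
Proof. by move=> x0 y0; rewrite !ltNge phi_le. Qed.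

Let integral_phi' a b : a < b ->
  (\int[leb]_(x in `]a, b]) (phi' x)%:E = (phi b - phi a)%:E)%E.
Proof.
move=> ab; rewrite integral_itv_obnd_cbnd; last first.
  by apply/measurable_EFinP; exact: measurable_funTS.
rewrite (@continuous_FTC2 _ phi' phi)//.
- by apply: continuous_subspaceT => x; exact: cphi'.
- split=> [x _||]; first exact: ex_derive.
  + by apply: cvg_at_right_filter; exact: cphi.
  + by apply: cvg_at_left_filter; exact: cphi.
- by move=> x _; rewrite derive1E derive_val.
Qed.

(** The image under [phi] of the measure phi'(y) dy on the half-line. The substitution rule amounts
    to its equality with Lebesgue measure there. *)
Definition subst_measure (A : set (measurableTypeR R)) : \bar R :=
  (\int[leb]_(y in pos `&` phi @^-1` A) (phi' y)%:E)%E.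

Let phi'_pos y : pos y -> (0 <= (phi' y)%:E)%E.
Proof. by move=> y0; rewrite lee_fin phi'_ge0// ltW. Qed.

Let subst_measure0 : subst_measure set0 = 0%E.
Proof. by rewrite /subst_measure preimage_set0 setI0 integral_set0. Qed.

Let subst_measure_ge0 A : (0 <= subst_measure A)%E.
Proof. by apply: integral_ge0 => y [y0 _]; exact: phi'_pos. Qed.

Let subst_measure_sigma_additive : semi_sigma_additive subst_measure.
Proof.
move=> /= F mF tF mUF; rewrite /subst_measure preimage_bigcup setI_bigcupr.
apply: cvg_toP.
  apply: ereal_nondecreasing_is_cvgn => m n mn.
  apply: lee_sum_nneg_natr => // k _ _; apply: integral_ge0 => y [y0 _].
  exact: phi'_pos.
rewrite ge0_integral_bigcup//=.
- by move=> k; exact: mpre.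
- by apply/measurable_funTS/measurable_EFinP.
- by move=> y [k _ [y0 _]]; exact: phi'_pos.
- apply/trivIsetP => i j _ _ ij; rewrite setIACA setIid -preimage_setI.
  by move/trivIsetP : tF => -> //; rewrite preimage_set0 setI0.
Qed.

HB.instance Definition _ := isMeasure.Build _ _ _ subst_measure
  subst_measure0 subst_measure_ge0 subst_measure_sigma_additive.

(** Two measures that agree on half-open intervals and are finite on an exhausting sequence of them
    coincide; on intervals the claim is the fundamental theorem of calculus. *)
Lemma subst_measureE A : measurable A -> leb (pos `&` A) = subst_measure A.
Proof.
move=> mA; rewrite setIC -[LHS]/(mrestr leb mpos A).
pose g (n : nat) : set (measurableTypeR R) := `] (- n%:R), n%:R]%classic.
apply: (@measure_unique _ _ (measurableTypeR R) (@ocitv R) g _ _ _ _ (mrestr leb mpos) subst_measure) => //.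
- exact: ocitvI.
- by move=> n; exact: is_ocitv.
- exact: bigcup_itvT.
- move=> _ [[a b]] _ <- /=; rewrite /mrestr /subst_measure.
  (* The interval may reach into the negative axis, so its ends are clipped at 0 before being pulled
     back. *)
  have [a' a'0 phia] : exists2 x, 0 <= x & phi x = Num.max a 0.
    by apply: phi_surj; rewrite le_max lexx orbT.
  have [b' b'0 phib] : exists2 x, 0 <= x & phi x = Num.max b 0.
    by apply: phi_surj; rewrite le_max lexx orbT.
  rewrite (_ : _ `&` pos = `]phi a', phi b']%classic); last first.
    rewrite phia phib; apply/seteqP; split=> x /=; rewrite !in_itv/=.
      by move=> [/andP[ax xb] x0]; rewrite gt_max ax x0 le_max xb.
    rewrite gt_max le_max => /andP[/andP[ax x0] /orP[->|x0']]; rewrite ?ax//.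
    by rewrite ltNge x0' in x0.
  rewrite (_ : pos `&` _ = `]a', b']%classic); last first.
    apply/seteqP; split=> x /=; rewrite !in_itv/=.
      move=> [x0 /andP[ax xb]].
      by rewrite -phi_ltE ?(ltW x0)// -phi_le ?(ltW x0)// phia phib gt_max ax
        -{1}phi0 phi_ltE ?lexx ?(ltW x0)// x0 le_max xb.
    move=> /andP[ax xb]; have x0 : 0 < x by exact: le_lt_trans ax.
    split=> //; move: ax xb; rewrite -phi_ltE ?(ltW x0)// -phi_le ?(ltW x0)//.
    rewrite phia phib gt_max le_max => /andP[-> _] /orP[//|].
    by rewrite -[X in _ <= X]phi0 phi_le ?(ltW x0)// leNgt x0.
  have [ab|ba] := ltP a' b'.
    rewrite integral_phi'// lebesgue_measure_itv /= lte_fin phi_ltE// ab.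
    by rewrite EFinB.
  by rewrite !set_itv_ge ?bnd_simp -?leNgt ?phi_le// measure0 integral_set0.
- move=> n; rewrite /mrestr; apply: (@le_lt_trans _ _ (leb (g n))).
    apply: le_measure; rewrite ?inE; [|exact: measurable_itv|exact: subIsetl].
    by apply: measurableI => //; exact: measurable_itv.
  by rewrite lebesgue_measure_itv/=; case: ifP; rewrite ?ltry// -EFinB ltry.
Qed.

Import HBNNSimple.

Let subst_nnsfun (f : {nnsfun (measurableTypeR R) >-> R}) :
  (\int[leb]_(x in pos) (f x)%:E =
   \int[leb]_(y in pos) (f (phi y) * phi' y)%:E)%E.
Proof.
under [LHS]eq_integral do rewrite fimfunE -fsumEFin//.
rewrite [LHS]ge0_integral_fsum//; last 2 first.
  - by move=> r; apply/measurable_funTS/measurable_EFinP/measurableT_comp.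
  - by move=> n x _; rewrite EFinM nnfun_muleindic_ge0.
under [RHS]eq_integral.
  move=> y y0; rewrite fimfunE EFinM muleC -fsumEFin// ge0_mule_fsumr; last first.
    by move=> r; rewrite EFinM nnfun_muleindic_ge0.
  over.
rewrite [RHS]ge0_integral_fsum//; last 2 first.
  - move=> r; apply/measurable_funTS/emeasurable_funM.
      exact/measurable_EFinP.
    apply/measurable_EFinP; apply: measurable_funM => //.
    by apply: (measurableT_comp _ mphi).
  - move=> n x x0; rewrite mule_ge0//; first exact: phi'_pos.
    by rewrite EFinM nnfun_muleindic_ge0.
apply: eq_fsbigr => r _; rewrite integralZl_indic_nnsfun// integral_indic//.
have [r0|r0] := leP 0 r; last first.
  by rewrite preimage_nnfun0//= set0I measure0 mule0 integral0_eq// => y _;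
    rewrite indic0 mulr0 mule0.
rewrite [X in (_ * X)%E](_ : _ = subst_measure (f @^-1` [set r])); last first.
  by rewrite setIC; exact: subst_measureE.
rewrite /subst_measure integral_mkcondr -ge0_integralZl//.
- apply: eq_integral => y _; rewrite patchE EFinM muleCA.
  rewrite indicE; case: ifPn => yA; first by rewrite mem_set ?mule1// -inE.
  by rewrite memNset ?mule0// => fy; move: yA; rewrite notin_setE; apply.
- apply/measurable_restrict => //; last by apply/measurable_funTS/measurable_EFinP.
  by rewrite -[X in measurable X]setTI; exact: mphi.
- by move=> y y0; rewrite patchE; case: ifP => // _; exact: phi'_pos.
Qed.

(** Measurability is the right generality: in several variables the integrand arises by integrating
    out the other coordinates. *)
Lemma ge0_integration_by_substitution_pos (f : measurableTypeR R -> \bar R) :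
  measurable_fun setT f -> (forall x, 0 <= f x)%E ->
  (\int[leb]_(x in pos) f x = \int[leb]_(y in pos) (f (phi y) * (phi' y)%:E))%E.
Proof.
move=> mf f0.
pose f_ := nnsfun_approx measurableT mf.
transitivity (lim (\int[leb]_(x in pos) (f_ n x)%:E @[n --> \oo])%E).
  rewrite -monotone_convergence//=.
  - apply: eq_integral => ? /[!inE] xD; apply/esym/cvg_lim => //=.
    exact: cvg_nnsfun_approx.
  - by move=> n; exact/measurable_EFinP/measurable_funTS.
  - by move=> n ? _; rewrite lee_fin.
  - by move=> ? _ ? ? mn; rewrite lee_fin; exact/lefP/nd_nnsfun_approx.
under eq_fun do rewrite subst_nnsfun.
rewrite -monotone_convergence//=.
- apply: eq_integral => y /[!inE] y0; apply/cvg_lim => //=.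
  under eq_fun do rewrite EFinM.
  by apply: cvgeZr => //; exact: cvg_nnsfun_approx.
- move=> n; apply/measurable_funTS/measurable_EFinP/measurable_funM => //.
  exact: (measurableT_comp _ mphi).
- by move=> n y y0; rewrite lee_fin mulr_ge0//; apply: phi'_ge0; exact: ltW.
- move=> y y0 m n mn; rewrite lee_fin ler_wpM2r//; first by apply: phi'_ge0; exact: ltW.
  by have /lefP := nd_nnsfun_approx measurableT mf mn; exact.
Qed.
End substitution.

(** * Iterated integrals over the positive orthant *)

Section orthant.
Context {R : realType}.
Local Notation leb := (@lebesgue_measure R).
Local Notation T N := (N.-tuple (measurableTypeR R)).

Definition pos_half : set (measurableTypeR R) := [set x | 0 < x].

Lemma measurable_pos_half : measurable pos_half.
Proof.
rewrite (_ : pos_half = `]0, +oo[%classic); first exact: measurable_itv.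
by apply/seteqP; split => x /=; rewrite in_itv/= andbT.
Qed.

Lemma measurable_pos_orthant N : measurable (@pos_orthant R N).
Proof.
rewrite (_ : @pos_orthant R N = \bigcap_(l in [set: 'I_N]) ((fun t : T N => tnth t l) @^-1` pos_half)).
  apply: fin_bigcap_measurable => // l _; rewrite -[X in measurable X]setTI.
  by apply: measurable_tnth => //; exact: measurable_pos_half.
by apply/seteqP; split => t /= h l; [move=> _; exact: h|exact: (h l I)].
Qed.

Lemma integral_orthant0 (F : T 0 -> \bar R) : (forall t, 0 <= F t)%E ->
  measurable_fun setT F ->
  (\int[lebesgue_tuple 0]_(t in @pos_orthant R 0) F t = F [tuple])%E.
Proof.
move=> F0 mF; rewrite integral_dirac//=; first last.
- exact: measurable_funTS.
- exact: measurable_pos_orthant.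
by rewrite diracE mem_set ?mul1e// => -[].
Qed.

(** Tonelli for the extension of [F] by zero. Nonnegativity is restricted to the orthant because
    Jacobian factors may be negative elsewhere. *)
Lemma integral_orthantS N (F : T N.+1 -> \bar R) :
  (forall t, pos_orthant t -> 0 <= F t)%E ->
  measurable_fun setT F ->
  (\int[lebesgue_tuple N.+1]_(t in @pos_orthant R N.+1) F t =
   \int[leb]_(x in pos_half) \int[lebesgue_tuple N]_(t in @pos_orthant R N)
     F (tuple_cons (x, t)))%E.
Proof.
move=> F0 mF.
have mD := @measurable_pos_orthant N.+1.
pose G := F \_ (@pos_orthant R N.+1).
have G0 t : (0 <= G t)%E by rewrite /G patchE; case: ifPn => //; rewrite inE => /F0.
have mG : measurable_fun setT G by apply: (measurable_restrictT F mD).1; exact: measurable_funTS.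
rewrite integral_mkcond -/G.
transitivity (\int[(leb \x lebesgue_tuple N)%E]_(z in @tuple_cons R N @^-1` setT)
    (G \o @tuple_cons R N) z)%E.
  by rewrite -(ge0_integral_pushforward (@measurable_tuple_cons R N))//.
rewrite preimage_setT fubini_tonelli1//; last 2 first.
- exact: (measurableT_comp mG (@measurable_tuple_cons R N)).
- by move=> z; exact: G0.
rewrite [RHS]integral_mkcond; apply: eq_integral => x _; rewrite /fubini_F patchE.
case: ifPn => [|]; rewrite ?inE ?notin_setE => x0.
  rewrite [RHS]integral_mkcond; apply: eq_integral => t _.
  rewrite /G /= !patchE; congr (if _ then _ else _).
  apply/idP/idP; rewrite !inE => h.
    move=> l; have := h (lift ord0 l); by rewrite !(tnth_nth 0) /=.
  move=> l; rewrite (tnth_nth 0) /=; case: (unliftP ord0 l) => [j|] -> //=.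
  by have := h j; rewrite (tnth_nth 0).
rewrite integral0_eq// => t _; rewrite /G /= patchE ifF//.
apply/negbTE; rewrite notin_setE => h; apply: x0.
by have := h ord0; rewrite (tnth_nth 0).
Qed.

Lemma tnth_tuple_cons0 N (x : measurableTypeR R) (t : T N) :
  tnth (tuple_cons (x, t)) ord0 = x.
Proof. by rewrite (tnth_nth 0). Qed.

Lemma tnth_tuple_consS N (x : measurableTypeR R) (t : T N) l :
  tnth (tuple_cons (x, t)) (lift ord0 l) = tnth t l.
Proof. by rewrite !(tnth_nth 0). Qed.

Lemma measurable_coord_prod N (g : 'I_N -> measurableTypeR R -> R) :
  (forall l, measurable_fun setT (g l)) ->
  measurable_fun setT (fun t : T N => \prod_(l < N) g l (tnth t l)).
Proof.
move=> mg; apply: measurable_prod => l _.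
exact: (measurableT_comp (mg l) (measurable_tnth l)).
Qed.

(** The factors vary with the coordinate so that coordinates can be confined to disjoint intervals
    in [partition_function_gt0]. *)
Lemma integral_orthant_prod N (g : 'I_N -> measurableTypeR R -> R) (c : 'I_N -> R) :
  (forall l, measurable_fun setT (g l)) -> (forall l x, 0 <= g l x) ->
  (forall l, \int[leb]_(x in pos_half) (g l x)%:E = (c l)%:E)%E ->
  (\int[lebesgue_tuple N]_(t in @pos_orthant R N)
     (\prod_(l < N) g l (tnth t l))%:E = (\prod_(l < N) c l)%:E)%E.
Proof.
elim: N g c => [|N IH] g c mg g0 gc.
  rewrite integral_orthant0 ?big_ord0//.
    by move=> t; rewrite lee_fin prodr_ge0.
  by apply/measurable_EFinP; exact: measurable_coord_prod.
rewrite integral_orthantS; last 2 first.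
- by move=> t _; rewrite lee_fin prodr_ge0.
- by apply/measurable_EFinP; exact: measurable_coord_prod.
have mD := @measurable_pos_orthant N.
transitivity (\int[leb]_(x in pos_half)
   ((\prod_(l < N) c (lift ord0 l))%:E * (g ord0 x)%:E))%E.
  apply: eq_integral => x _.
  rewrite -(IH (fun l => g (lift ord0 l)) (fun l => c (lift ord0 l)))//.
  rewrite -ge0_integralZr//; last 3 first.
  - apply/measurable_funTS/measurable_EFinP.
    exact: (@measurable_coord_prod N (fun l => g (lift ord0 l))).
  - by move=> t _; rewrite lee_fin prodr_ge0.
  - by rewrite lee_fin.
  apply: eq_integral => t _; rewrite -EFinM big_ord_recl tnth_tuple_cons0 mulrC.
  by under eq_bigr do rewrite tnth_tuple_consS.
have c0 l : 0 <= c l.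
  by rewrite -lee_fin -gc; apply: integral_ge0 => x _; rewrite lee_fin.
rewrite ge0_integralZl//; last 4 first.
- exact: measurable_pos_half.
- by apply/measurable_funTS/measurable_EFinP.
- by move=> x _; rewrite lee_fin.
- by rewrite lee_fin prodr_ge0.
by rewrite gc -EFinM [in RHS]big_ord_recl mulrC.
Qed.

End orthant.

Section orthant_substitution.
Context {R : realType}.
Local Notation leb := (@lebesgue_measure R).
Local Notation T N := (N.-tuple (measurableTypeR R)).
Variables (phi phi' : R -> R).
Hypothesis dphi : forall x, is_derive x (1 : R) phi (phi' x).
Hypothesis cphi' : continuous phi'.
Hypothesis phi'_ge0 : forall x, 0 <= x -> 0 <= phi' x.
Hypothesis phi0 : phi 0 = 0.
Hypothesis phi_lt : forall x y, 0 <= x -> x < y -> phi x < phi y.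
Hypothesis phi_surj : forall y, 0 <= y -> exists2 x, 0 <= x & phi x = y.

Let mphi : measurable_fun setT (phi : measurableTypeR R -> measurableTypeR R).
Proof.
apply: continuous_measurable_fun => x.
by apply/differentiable_continuous/derivable1_diffP; exact: ex_derive.
Qed.

Let mphi' : measurable_fun setT (phi' : measurableTypeR R -> R).
Proof. exact: continuous_measurable_fun. Qed.

Lemma measurable_map_tuple (f : measurableTypeR R -> measurableTypeR R) N :
  measurable_fun setT f -> measurable_fun setT (map_tuple f : T N -> T N).
Proof.
move=> mf; apply/measurable_fun_tnthP => i.
rewrite (_ : _ \o _ = f \o (fun t : T N => tnth t i)).
  exact: (measurableT_comp mf (measurable_tnth i)).
by apply/funext => t; rewrite /= tnth_map.
Qed.

Lemma measurable_coord_prod1 N (g : measurableTypeR R -> R) :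
  measurable_fun setT g ->
  measurable_fun setT (fun t : T N => (\prod_(l < N) g (tnth t l))%:E).
Proof.
by move=> mg; apply/measurable_EFinP; exact: (@measurable_coord_prod R N (fun=> g)).
Qed.

(** The map acts on each coordinate separately, so induction on [N] reduces to one-variable
    substitution and Tonelli. *)
Lemma integral_orthant_substitution N (F : T N -> \bar R) :
  (forall t, 0 <= F t)%E -> measurable_fun setT F ->
  (\int[lebesgue_tuple N]_(t in @pos_orthant R N) F t =
   \int[lebesgue_tuple N]_(t in @pos_orthant R N)
     (F (map_tuple phi t) * (\prod_(l < N) phi' (tnth t l))%:E))%E.
Proof.
have mprod N' : measurable_fun setT (fun t : T N' => (\prod_(l < N') phi' (tnth t l))%:E).
  exact: measurable_coord_prod1.
have prod_ge0 N' (t : T N') : pos_orthant t -> (0 <= (\prod_(l < N') phi' (tnth t l))%:E)%E.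
  by move=> tD; rewrite lee_fin prodr_ge0// => l _; apply: phi'_ge0; apply: ltW; exact: tD.
have mFmap N' (G : T N' -> \bar R) : measurable_fun setT G ->
    measurable_fun setT (fun t : T N' => G (map_tuple phi t) * (\prod_(l < N') phi' (tnth t l))%:E)%E.
  move=> mG; apply: emeasurable_funM; last exact: mprod.
  exact: measurableT_comp mG (measurable_map_tuple mphi).
elim: N F => [|N IH] F F0 mF.
  rewrite (integral_orthant0 F0 mF) integral_orthant0; last 2 first.
  - by move=> t; rewrite mule_ge0// big_ord0.
  - exact: mFmap.
  by rewrite big_ord0 mule1; congr F; exact: val_inj.
have mD := @measurable_pos_orthant R N.
have mFcons (x : measurableTypeR R) : measurable_fun setT (fun t : T N => F (tuple_cons (x, t))).
  apply: (measurableT_comp mF); apply: (measurableT_comp (@measurable_tuple_cons R N)).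
  exact: pair1_measurable.
pose g x := (\int[lebesgue_tuple N]_(t in @pos_orthant R N)
  (F (tuple_cons (x, map_tuple phi t)) * (\prod_(l < N) phi' (tnth t l))%:E))%E.
rewrite !integral_orthantS//; last 2 first.
- by move=> t /prod_ge0 ?; rewrite mule_ge0.
- exact: mFmap.
transitivity (\int[leb]_(x in pos_half) g x)%E.
  by apply: eq_integral => x _; rewrite (IH (fun t => F (tuple_cons (x, t)))).
have g0 x : (0 <= g x)%E.
  by apply: integral_ge0 => t /prod_ge0 ?; rewrite mule_ge0.
have mg : measurable_fun setT g.
  (* Measurability of [g] comes from Tonelli, applied to the integrand extended by zero in the
     second variable. *)
  pose G (z : measurableTypeR R * T N) := ((fun t =>
    F (tuple_cons (z.1, map_tuple phi t)) * (\prod_(l < N) phi' (tnth t l))%:E) \_ (@pos_orthant R N) z.2)%E.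
  rewrite (_ : g = fubini_F (lebesgue_tuple N) G); last first.
    by apply/funext => x; rewrite /g integral_mkcond.
  apply: measurable_fun_fubini_tonelli_F.
    rewrite (_ : G = (fun z => F (tuple_cons (z.1, map_tuple phi z.2)) *
        (\prod_(l < N) phi' (tnth z.2 l))%:E)%E \_ (snd @^-1` @pos_orthant R N))//.
    apply: (measurable_restrictT _ _).1.
      by rewrite -[X in measurable X]setTI; exact: measurable_snd.
    apply: measurable_funTS; apply: emeasurable_funM.
      apply: (measurableT_comp mF); apply: (measurableT_comp (@measurable_tuple_cons R N)).
      apply/measurable_fun_pairP; split; first exact: measurable_fst.
      exact: measurableT_comp (measurable_map_tuple mphi) measurable_snd.
    exact: measurableT_comp (mprod N) measurable_snd.
  move=> z; rewrite /G patchE; case: ifP => //.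
  by rewrite inE => /prod_ge0 ?; rewrite mule_ge0.
rewrite (ge0_integration_by_substitution_pos dphi)//.
apply: eq_integral => x; rewrite inE => x0; rewrite /g -ge0_integralZr//; last 3 first.
- apply/measurable_funTS/emeasurable_funM; last exact: mprod.
  exact: measurableT_comp (mFcons (phi x)) (measurable_map_tuple mphi).
- by move=> t /prod_ge0 ?; rewrite mule_ge0.
- by rewrite lee_fin phi'_ge0// ltW.
apply: eq_integral => t _; rewrite big_ord_recl tnth_tuple_cons0 [in RHS]mulrC EFinM muleA.
congr (F _ * _%:E * _)%E; first exact: val_inj.
by apply: eq_bigr => l _; rewrite tnth_tuple_consS.
Qed.

End orthant_substitution.

(** * Integrability *)

Section gamma_moments.
Context {R : realType}.
Local Notation leb := (@lebesgue_measure R).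
Implicit Types (x b c : R).

Lemma expr_le_fact_expR n x : 0 <= x -> x ^+ n <= n`!%:R * expR x.
Proof.
case: n => [|n] x0.
  by rewrite expr0 fact0 mul1r -expR0 ler_expR.
rewrite mulrC -ler_pdivrMr ?ltr0n ?fact_gt0//.
by apply: le_trans (expR_ge1Dxn n x0); rewrite lerDr.
Qed.

(** The integrand may be unbounded at 0, so the primitive is used on intervals exhausting []0,
    1]]. *)
Lemma integral_powR_01 b : -1 < b ->
  (\int[leb]_(x in (`]0%R, 1%R]%classic : set (measurableTypeR R))) (x `^ b)%:E <= ((b + 1)^-1)%:E)%E.
Proof.
move=> b1; have b10 : 0 < b + 1 by rewrite -ltrBlDr sub0r.
have mpow : measurable_fun setT (fun x : measurableTypeR R => (x `^ b)%:E).
  by apply/measurable_EFinP; exact: measurable_powR.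
(* [n.+2] keeps the left end strictly below 1, so the interval is never degenerate. *)
pose F (n : nat) : set (measurableTypeR R) := `[ n.+2%:R^-1, 1%R ]%classic.
have F01 n : n.+2%:R^-1 < 1 :> R by rewrite invf_lt1 ?ltr1n ?ltr0n.
have Fpos n : 0 < n.+2%:R^-1 :> R by rewrite invr_gt0 ltr0n.
have UF : (`]0%R, 1%R]%classic : set (measurableTypeR R)) = \bigcup_n F n.
  apply/seteqP; split => x /=.
    rewrite in_itv/= => /andP[x0 x1]; exists (Num.bound x^-1) => //.
    have xV0 : 0 < x^-1 by rewrite invr_gt0.
    have xb : x^-1 <= (Num.bound x^-1).+2%:R.
      by rewrite (le_trans (ltW (archi_boundP (ltW xV0))))// ler_nat ltnW.
    by rewrite /F /= in_itv/= x1 andbT -[leRHS]invrK lef_pV2 ?posrE ?ltr0n.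
  move=> [n _]; rewrite /F /= !in_itv/= => /andP[nx ->]; rewrite andbT.
  exact: lt_le_trans nx.
have ndF : nondecreasing_seq F.
  move=> m k mk; rewrite subsetEset => x; rewrite /F /= !in_itv/= => /andP[mx ->].
  by rewrite andbT (le_trans _ mx)// lef_pV2 ?posrE ?ltr0n// ler_nat !ltnS.
have mF n : measurable (F n) by exact: measurable_itv.
rewrite UF -(cvg_lim _ (ge0_nondecreasing_set_cvg_integral (mu := leb) ndF mF _ _))//; last 2 first.
- by move=> k; exact: measurable_funTS.
- by move=> k x _; rewrite lee_fin powR_ge0.
apply: lime_le.
  apply/cvg_ex; eexists; apply: (ge0_nondecreasing_set_cvg_integral (mu := leb) ndF mF).
    by move=> n; exact: measurable_funTS.
  by move=> n x _; rewrite lee_fin powR_ge0.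
apply: nearW => n.
have pos x : x \in F n -> 0 < x.
  by rewrite inE /F /= in_itv/= => /andP[+ _]; exact: lt_le_trans.
have dG x : 0 < x -> is_derive x (1 : R) (fun y => (b + 1)^-1 * y `^ (b + 1)) (x `^ b).
  move=> x0; have := is_derive1_powR (b + 1) x0; rewrite addrK => h.
  have := is_deriveZ (b + 1)^-1 h.
  by rewrite /GRing.scale /= mulKf// gt_eqF.
have cG x : 0 < x -> {for x, continuous (fun y => (b + 1)^-1 * y `^ (b + 1))}.
  move=> /dG h; apply/differentiable_continuous/derivable1_diffP; exact: ex_derive.
have cpow x : 0 < x -> {for x, continuous (fun y => y `^ b)}.
  move=> x0; have h := is_derive1_powR b x0.
  apply/differentiable_continuous/derivable1_diffP; exact: ex_derive.
rewrite (@continuous_FTC2 _ (fun y => y `^ b) (fun y => (b + 1)^-1 * y `^ (b + 1)))//.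
- rewrite powR1 mulr1 -EFinB lee_fin gerBl.
  by rewrite mulr_ge0 ?powR_ge0// invr_ge0 ltW.
- apply: continuous_in_subspaceT => x /pos; exact: cpow.
- split=> [x||].
  + rewrite in_itv/= => /andP[nx _]; have := dG x (lt_trans (Fpos n) nx).
    by move=> ?; exact: ex_derive.
  + by apply: cvg_at_right_filter; exact: cG.
  + by apply: cvg_at_left_filter; exact: cG.
- move=> x; rewrite in_itv/= => /andP[nx _]; have := dG x (lt_trans (Fpos n) nx).
  by move=> ?; rewrite derive1E derive_val.
Qed.

Lemma gamma_moment_lty b c m : -1 < b -> 0 < c ->
  (\int[leb]_(x in pos_half) (x `^ b * expR (- (c * x)) * (1 + x) ^+ m)%:E < +oo)%E.
Proof.
move=> b1 c0; have b10 : 0 < b + 1 by rewrite -ltrBlDr sub0r.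
pose M := Num.bound `|b|.
have bM : b <= M%:R by rewrite (le_trans (ler_norm _))// ltW// archi_boundP.
pose r := c / 2; have r0 : 0 < r by rewrite divr_gt0.
(* Beyond 1, half of the decay pays for the polynomial: y^j <= j! exp y with y = r (1 + x) and j = m
   + M. The last [r^-1] cancels the normalisation of [exponential_pdf]. *)
pose K := (m + M)`!%:R * (r^-1 ^+ (m + M) * (expR r * r^-1)).
have K0 : 0 <= K by rewrite !mulr_ge0// ?exprn_ge0 ?invr_ge0 ?expR_ge0// ltW.
pose f x := x `^ b * expR (- (c * x)) * (1 + x) ^+ m.
pose g1 := (fun x => (x `^ b)%:E) \_ (`]0%R, 1%R]%classic : set (measurableTypeR R)).
pose g2 x := (exponential_pdf r x)%:E.
have mf : measurable_fun setT (f : measurableTypeR R -> R).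
  apply: measurable_funM.
    apply: measurable_funM; first exact: measurable_powR.
    by apply: measurableT_comp => //; apply: measurableT_comp => //; exact: measurable_funM.
  by apply: measurable_funX; exact: measurable_funD.
have mg1 : measurable_fun setT (g1 : measurableTypeR R -> \bar R).
  apply: (measurable_restrictT _ _).1 => //; apply: measurable_funTS.
  by apply/measurable_EFinP; exact: measurable_powR.
have mg2 : measurable_fun setT (g2 : measurableTypeR R -> \bar R).
  by apply/measurable_EFinP; exact: measurable_exponential_pdf.
have g10 x : (0 <= g1 x)%E.
  by rewrite /g1 patchE; case: ifP => // _; rewrite lee_fin powR_ge0.
have g20 x : (0 <= g2 x)%E by rewrite lee_fin exponential_pdf_ge0// ltW.
have fle x : 0 < x -> ((f x)%:E <= (2 ^+ m)%:E * g1 x + K%:E * g2 x)%E.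
  move=> x0; have [x1|x1] := leP x 1.
    have -> : g1 x = (x `^ b)%:E by rewrite /g1 patchE mem_set//= in_itv/= x0.
    apply: (@le_trans _ _ ((2 ^+ m)%:E * (x `^ b)%:E)%E); last by rewrite leeDl// mule_ge0// lee_fin.
    rewrite -EFinM lee_fin /f [leLHS]mulrC; apply: ler_pM.
    - by rewrite exprn_ge0// addr_ge0// ltW.
    - by rewrite mulr_ge0// ?powR_ge0// expR_ge0.
    - by apply: lerXn2r; rewrite ?nnegrE; lra.
    - rewrite ger_pMr ?powR_gt0// -expR0 ler_expR; nra.
  apply: (@le_trans _ _ (K%:E * g2 x)%E); last by rewrite leeDr// mule_ge0// lee_fin exprn_ge0.
  rewrite /g2 exponential_pdfE ?(ltW x0)// -EFinM lee_fin.
  have xb : x `^ b <= (1 + x) ^+ M.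
    rewrite (le_trans (ler_powR (ltW x1) bM))// powR_mulrn ?(ltW x0)//.
    by apply: lerXn2r; rewrite ?nnegrE; lra.
  have poly : (1 + x) ^+ (m + M) <= (m + M)`!%:R * (r^-1 ^+ (m + M) * (expR r * expR (r * x))).
    have := @expr_le_fact_expR (m + M) (r * (1 + x)); rewrite mulr_ge0 ?(ltW r0)//; last lra.
    move=> /(_ isT); rewrite exprMn mulrDr mulr1 expRD.
    rewrite -ler_pdivlMl ?exprn_gt0// => /le_trans; apply.
    by rewrite exprVn mulrCA.
  rewrite /f mulrAC [_ * (1 + x) ^+ m]mulrC.
  apply: (@le_trans _ _ ((1 + x) ^+ (m + M) * expR (- (c * x)))).
    rewrite ler_wpM2r ?expR_ge0// exprD ler_wpM2l// exprn_ge0//; lra.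
  apply: (@le_trans _ _ ((m + M)`!%:R * (r^-1 ^+ (m + M) * (expR r * expR (r * x))) * expR (- (c * x)))).
    by rewrite ler_wpM2r ?expR_ge0.
  rewrite le_eqVlt; apply/orP; left; apply/eqP.
  have -> : - (c * x) = - r * x + - r * x by rewrite /r; field.
  rewrite expRD /K.
  have -> : expR (r * x) = (expR (- r * x))^-1 by rewrite -expRN mulNr opprK.
  field.
  by rewrite expR_eq0 gt_eqF.
apply: (@le_lt_trans _ _ (\int[leb]_(x in pos_half) ((2 ^+ m)%:E * g1 x + K%:E * g2 x))%E).
  apply: ge0_le_integral => //=.
  - exact: measurable_pos_half.
  - move=> x x0; rewrite lee_fin !mulr_ge0 ?powR_ge0 ?expR_ge0 ?exprn_ge0//.
    by rewrite addr_ge0// ltW.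
  - by apply: measurable_funTS; apply/measurable_EFinP.
  - by apply: measurable_funTS; apply: emeasurable_funD; exact: measurable_funeM.
have mpos := @measurable_pos_half R.
rewrite ge0_integralD//; last 4 first.
- by move=> x _; rewrite mule_ge0.
- by apply: measurable_funTS; exact: measurable_funeM.
- by move=> x _; rewrite mule_ge0.
- by apply: measurable_funTS; exact: measurable_funeM.
rewrite !ge0_integralZl//; try exact: measurable_funTS.
apply: lte_add_pinfty; apply: lte_mul_pinfty => //.
- rewrite /g1 -integral_mkcondr (le_lt_trans _ (ltry (b + 1)^-1))//.
  apply: le_trans (integral_powR_01 b1).
  apply: ge0_subset_integral => //.
  + exact: measurableI.
  + by apply: measurable_funTS; apply/measurable_EFinP; exact: measurable_powR.
  + by move=> x _; rewrite lee_fin powR_ge0.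
- apply: (@le_lt_trans _ _ (\int[leb]_x g2 x)%E).
    exact: ge0_subset_integral.
  by rewrite integral_exponential_pdf// ltry.
Qed.

End gamma_moments.

(** * Functions of polynomial growth on the orthant *)

Section tempered.
Context {R : realType}.
Local Notation leb := (@lebesgue_measure R).
Local Notation T N := (N.-tuple (measurableTypeR R)).

(** A product over coordinates rather than a norm, so that integrals of its powers against a product
    weight factorise. *)
Definition growth N (t : T N) : R := \prod_(l < N) (1 + `|tnth t l : R|).

Lemma growth_ge1 N (t : T N) : 1 <= growth t.
Proof.
by apply: (big_ind (fun x : R => 1 <= x)) => // [x y x1 y1|l _]; [exact: mulr_ege1|rewrite lerDl].
Qed.

Lemma growth_ge0 N (t : T N) : 0 <= growth t.
Proof. exact: le_trans (growth_ge1 t). Qed.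

Lemma coord_le_growth N (t : T N) l : `|tnth t l : R| <= growth t.
Proof.
rewrite /growth (bigD1 l)//=; apply: (@le_trans _ _ (1 + `|tnth t l : R|)).
  by rewrite lerDr.
rewrite ler_peMr ?addr_ge0//.
by apply: (big_ind (fun x : R => 1 <= x)) => // [x y x1 y1|i _]; [exact: mulr_ege1|rewrite lerDl].
Qed.

Lemma measurable_growth N : measurable_fun setT (@growth N).
Proof.
apply: (@measurable_coord_prod R N (fun _ x => 1 + `|x : R|)) => l.
by apply: measurable_funD => //; exact: measurableT_comp.
Qed.

Definition tempered N (f : T N -> R) := measurable_fun setT f /\
  exists K : nat, forall t, pos_orthant t -> `|f t| <= K%:R * growth t ^+ K.

Lemma tempered_cst N (r : R) : tempered (fun _ : T N => r).
Proof.
split; first exact: measurable_cst.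
exists (Num.bound `|r|) => t _.
apply: (@le_trans _ _ (Num.bound `|r|)%:R); first by rewrite ltW// archi_boundP.
by rewrite ler_peMr// exprn_ege1// growth_ge1.
Qed.

Lemma tempered_coord N (l : 'I_N) : tempered (fun t : T N => tnth t l : R).
Proof.
split; first exact: measurable_tnth.
by exists 1%N => t _; rewrite mul1r expr1 coord_le_growth.
Qed.

Lemma temperedD N (f g : T N -> R) :
  tempered f -> tempered g -> tempered (fun t => f t + g t).
Proof.
move=> [mf [K Kf]] [mg [L Lg]]; split; first exact: measurable_funD.
exists (K + L)%N => t tD; apply: (le_trans (ler_normD _ _)).
rewrite natrD mulrDl; apply: lerD.
  apply: (le_trans (Kf t tD)); rewrite ler_wpM2l//.
  by apply: ler_weXn2l; [exact: growth_ge1|exact: leq_addr].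
apply: (le_trans (Lg t tD)); rewrite ler_wpM2l//.
by apply: ler_weXn2l; [exact: growth_ge1|exact: leq_addl].
Qed.

Lemma temperedM N (f g : T N -> R) :
  tempered f -> tempered g -> tempered (fun t => f t * g t).
Proof.
(* The constant below must exceed [K * L] as a factor and [K + L] as an exponent. *)
move=> [mf [K Kf]] [mg [L Lg]]; split; first exact: measurable_funM.
exists (K * L + (K + L))%N => t tD; rewrite normrM.
apply: (@le_trans _ _ ((K%:R * growth t ^+ K) * (L%:R * growth t ^+ L))).
  by apply: ler_pM => //; [exact: Kf|exact: Lg].
rewrite mulrACA -natrM -exprD; apply: ler_pM; rewrite ?exprn_ge0 ?growth_ge0//.
  by rewrite ler_nat leq_addr.
by apply: ler_weXn2l; [exact: growth_ge1|exact: leq_addl].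
Qed.

Lemma temperedZ N (r : R) (f : T N -> R) : tempered f -> tempered (fun t => r * f t).
Proof. by move=> tf; apply: temperedM => //; exact: tempered_cst. Qed.

Lemma tempered_sum N (I : Type) (s : seq I) (P : pred I) (f : I -> T N -> R) :
  (forall i, tempered (f i)) -> tempered (fun t => \sum_(i <- s | P i) f i t).
Proof.
move=> tf; elim: s => [|i s IH].
  by under eq_fun do rewrite big_nil; exact: tempered_cst.
under eq_fun do rewrite big_cons; case: (P i) => //; exact: temperedD.
Qed.

Lemma tempered_prod N (I : Type) (s : seq I) (f : I -> T N -> R) :
  (forall i, tempered (f i)) -> tempered (fun t => \prod_(i <- s) f i t).
Proof.
move=> tf; elim: s => [|i s IH].
  by under eq_fun do rewrite big_nil; exact: tempered_cst.
by under eq_fun do rewrite big_cons; exact: temperedM.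
Qed.

Lemma temperedX N (f : T N -> R) n : tempered f -> tempered (fun t => f t ^+ n).
Proof.
move=> tf; elim: n => [|n IH]; first exact: tempered_cst.
by under eq_fun do rewrite exprS; exact: temperedM.
Qed.

Lemma tempered_power_sum N p : tempered (@power_sum R N p).
Proof. by apply: tempered_sum => l; apply: temperedX; exact: tempered_coord. Qed.

End tempered.

(** * Integrability and normalisation of the Laguerre density *)

Section laguerre.
Context {R : realType}.
Local Notation leb := (@lebesgue_measure R).
Local Notation T N := (N.-tuple (measurableTypeR R)).
Variables (b c kappa : R).
Hypotheses (b_gt : -1 < b) (c_gt0 : 0 < c) (kappa_gt0 : 0 < kappa).

(** Covers both ensembles: (b, c) is (kappa a, kappa) at low and (a, 1) at high temperature. *)
Definition laguerre_weight (x : R) : R := x `^ b * expR (- (c * x)).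

Let W N := @beta_weight R laguerre_weight kappa N.

Lemma laguerre_weight_ge0 x : 0 <= laguerre_weight x.
Proof. by rewrite mulr_ge0 ?powR_ge0 ?expR_ge0. Qed.

Lemma measurable_laguerre_weight :
  measurable_fun setT (laguerre_weight : measurableTypeR R -> R).
Proof.
apply: measurable_funM; first exact: measurable_powR.
by apply: measurableT_comp => //; apply: measurableT_comp => //; exact: measurable_funM.
Qed.

Lemma beta_weight_ge0 N (t : T N) : 0 <= W t.
Proof.
rewrite mulr_ge0 ?prodr_ge0// => [l _|j _]; first exact: laguerre_weight_ge0.
by rewrite prodr_ge0// => k _; exact: powR_ge0.
Qed.

Lemma measurable_beta_weight N : measurable_fun setT (@W N).
Proof.
apply: measurable_funM.
  apply: (@measurable_coord_prod R N (fun=> laguerre_weight)) => l.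
  exact: measurable_laguerre_weight.
apply: measurable_prod => j _.
under eq_fun do rewrite big_mkcond/=.
apply: measurable_prod => k _; case: (j < k)%N; last exact: measurable_cst.
apply: (measurableT_comp (measurable_powR _)); apply: measurableT_comp => //.
by apply: measurable_funB; exact: measurable_tnth.
Qed.

(** For positive x and y, |x - y| is at most max(x, y), hence at most [growth t]; so the interaction
    has polynomial growth. *)
Lemma beta_weight_le N : exists M : nat, forall t : T N, pos_orthant t ->
  W t <= (\prod_(l < N) laguerre_weight (tnth t l)) * growth t ^+ M.
Proof.
have [K kK] : exists K : nat, 2 * kappa <= K%:R.
  exists (Num.bound (2 * kappa)); apply: ltW; apply: archi_boundP.
  by rewrite mulr_ge0// ltW.
(* One exponent [K] for each of the N^2 ordered pairs; a pair absent from the density counts as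
   1. *)
exists (K * N * N)%N => t tD; rewrite /W /beta_weight.
rewrite ler_wpM2l ?prodr_ge0// => [l _|]; first exact: laguerre_weight_ge0.
rewrite exprM -[in X in _ <= _ ^+ X](card_ord N) -prodr_const.
apply: ler_prod => j _; apply/andP; split.
  by apply: prodr_ge0 => k _; exact: powR_ge0.
rewrite exprM -[in X in _ <= _ ^+ X](card_ord N) -prodr_const big_mkcond/=.
apply: ler_prod => k _; case: ifPn => jk; last by rewrite ler01 exprn_ege1// growth_ge1.
rewrite powR_ge0/= -powR_mulrn ?growth_ge0//.
apply: (@le_trans _ _ (growth t `^ (2 * kappa))); last by apply: ler_powR => //; exact: growth_ge1.
apply: ge0_ler_powR; rewrite ?nnegrE ?growth_ge0//; first by rewrite mulr_ge0// ltW.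
have tj := tD j; have tk := tD k.
have := coord_le_growth t j; have := coord_le_growth t k.
by rewrite (gtr0_norm tj) (gtr0_norm tk) => hk hj; rewrite ler_norml; lra.
Qed.

Lemma integral_growth_beta_weight_lty N m :
  (\int[lebesgue_tuple N]_(t in @pos_orthant R N) (growth t ^+ m * W t)%:E < +oo)%E.
Proof.
have [M WM] := beta_weight_le N.
pose g (l : 'I_N) (x : measurableTypeR R) : R := laguerre_weight x * (1 + `|x : R|) ^+ (m + M).
have mg l : measurable_fun setT (g l).
  apply: measurable_funM; first exact: measurable_laguerre_weight.
  apply: measurable_funX; apply: measurable_funD => //; exact: measurableT_comp.
have g0 l x : 0 <= g l x.
  by rewrite mulr_ge0 ?laguerre_weight_ge0// exprn_ge0// addr_ge0.
pose I := (\int[leb]_(x in pos_half) (laguerre_weight x * (1 + x) ^+ (m + M))%:E)%E.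
have I0 : (0 <= I)%E.
  apply: integral_ge0 => x x0; rewrite lee_fin mulr_ge0 ?laguerre_weight_ge0//.
  by rewrite exprn_ge0// addr_ge0// ltW.
have Ifin : I \is a fin_num by rewrite ge0_fin_numE// gamma_moment_lty.
have Ig l : (\int[leb]_(x in pos_half) (g l x)%:E = (fine I)%:E)%E.
  rewrite fineK//; apply: eq_integral => x; rewrite inE => x0.
  by rewrite /g gtr0_norm.
have mD := @measurable_pos_orthant R N.
apply: (@le_lt_trans _ _ (\int[lebesgue_tuple N]_(t in @pos_orthant R N)
    (\prod_(l < N) g l (tnth t l))%:E)%E).
  apply: ge0_le_integral => //=.
  - by move=> t _; rewrite lee_fin mulr_ge0 ?beta_weight_ge0// exprn_ge0// growth_ge0.
  - apply: measurable_funTS; apply/measurable_EFinP; apply: measurable_funM.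
      by apply: measurable_funX; exact: measurable_growth.
    exact: measurable_beta_weight.
  - by apply: measurable_funTS; apply/measurable_EFinP; exact: measurable_coord_prod.
  - move=> t tD; rewrite lee_fin big_split/= prodrXl -/(growth t) exprD mulrCA.
    by rewrite ler_wpM2l ?exprn_ge0 ?growth_ge0// WM.
by rewrite (integral_orthant_prod mg g0 Ig) ltry.
Qed.

Lemma integrable_tempered N (f : T N -> R) : tempered f ->
  (lebesgue_tuple N).-integrable (@pos_orthant R N) (EFin \o (fun t => f t * W t)).
Proof.
move=> [mf [K Kf]]; apply/integrableP; split.
  apply: measurable_funTS; apply/measurable_EFinP; apply: measurable_funM => //.
  exact: measurable_beta_weight.
have mgW : measurable_fun setT (fun t : T N => (growth t ^+ K * W t)%:E).
  apply/measurable_EFinP; apply: measurable_funM; last exact: measurable_beta_weight.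
  by apply: measurable_funX; exact: measurable_growth.
have mD := @measurable_pos_orthant R N.
apply: (@le_lt_trans _ _ (\int[lebesgue_tuple N]_(t in @pos_orthant R N)
    (K%:R%:E * (growth t ^+ K * W t)%:E))%E).
  apply: ge0_le_integral => //=.
  - apply: measurable_funTS; apply/measurable_EFinP; apply: measurableT_comp => //.
    by apply: measurable_funM => //; exact: measurable_beta_weight.
  - by apply: measurable_funTS; exact: measurable_funeM.
  - move=> t tD; rewrite -EFinM lee_fin normrM (ger0_norm (beta_weight_ge0 t)) [leRHS]mulrA.
    by rewrite ler_wpM2r ?beta_weight_ge0// Kf.
rewrite ge0_integralZl//; last 2 first.
- exact: measurable_funTS.
- by move=> t _; rewrite lee_fin mulr_ge0 ?beta_weight_ge0// exprn_ge0// growth_ge0.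
by rewrite lte_mul_pinfty// ?lee_fin// integral_growth_beta_weight_lty.
Qed.

Lemma laguerre_weight_ge x y : 1 <= x <= y ->
  expR (- ((`|b| + c) * y)) <= laguerre_weight x.
Proof.
move=> /andP[x1 xy]; have x0 : 0 < x by exact: lt_le_trans x1.
rewrite /laguerre_weight /powR gt_eqF// -expRD ler_expR.
have lnx0 : 0 <= ln x by exact: ln_ge0.
have lnx : ln x <= y.
  rewrite (le_trans _ xy)// -ler_expR lnK ?posrE// (le_trans _ (expR_ge1Dx x))//.
  by rewrite lerDr.
have cxy : c * x <= c * y by rewrite ler_wpM2l// ltW.
have bxy : `|b| * ln x <= `|b| * y by rewrite ler_wpM2l.
have : - b * ln x <= `|b| * ln x by rewrite ler_wpM2r// -normrN ler_norm.
lra.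
Qed.

Lemma partition_function_gt0 N :
  0 < \int[lebesgue_tuple N]_(t in @pos_orthant R N) W t.
Proof.
apply: fine_gt0; apply/andP; split; last first.
  have := integral_growth_beta_weight_lty N 0%N.
  apply: le_lt_trans; rewrite le_eqVlt; apply/orP; left; apply/eqP.
  by apply: eq_integral => t _; rewrite expr0 mul1r.
(* Coordinates in these intervals are at mutual distance at least 1, so the interaction is at least
   1, and they are at least 1, so [laguerre_weight_ge] applies. *)
pose J (l : 'I_N) : set (measurableTypeR R) := `[ (2 * l + 1)%:R, (2 * l + 2)%:R ]%classic.
pose d (l : 'I_N) : R := expR (- ((`|b| + c) * (2 * l + 2)%:R)).
pose g (l : 'I_N) (x : measurableTypeR R) : R := d l * \1_(J l) x.
have mJ l : measurable (J l) by exact: measurable_itv.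
have mg l : measurable_fun setT (g l).
  by apply: measurable_funM => //; exact: measurable_indic.
have g0 l x : 0 <= g l x by rewrite mulr_ge0 ?expR_ge0.
have gd l : (\int[leb]_(x in pos_half) (g l x)%:E = (d l)%:E)%E.
  rewrite /g; under eq_integral do rewrite EFinM.
  rewrite ge0_integralZl//; last 3 first.
  - exact: measurable_pos_half.
  - by apply: measurable_funTS; apply/measurable_EFinP; exact: measurable_indic.
  - by rewrite lee_fin expR_ge0.
  rewrite integral_indic//; last exact: measurable_pos_half.
  rewrite (_ : J l `&` pos_half = J l); last first.
    apply/setIidl => x; rewrite /J /= in_itv/= => /andP[+ _].
    by apply: lt_le_trans; rewrite ltr0n addn1.
  have J1 : leb (J l) = 1%E.
    rewrite /J lebesgue_measure_itv/= lte_fin ltr_nat ltn_add2l/= -EFinB.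
    by rewrite -natrB ?leq_add2l// subnDl.
  by rewrite [X in (_ * X)%E]J1 mule1.
have mD := @measurable_pos_orthant R N.
apply: (@lt_le_trans _ _ (\int[lebesgue_tuple N]_(t in @pos_orthant R N)
    (\prod_(l < N) g l (tnth t l))%:E)%E).
  by rewrite (integral_orthant_prod mg g0 gd) lte_fin prodr_gt0// => l _; exact: expR_gt0.
apply: ge0_le_integral => //=.
- by move=> t _; rewrite lee_fin prodr_ge0.
- by apply: measurable_funTS; apply/measurable_EFinP; exact: measurable_coord_prod.
- by apply: measurable_funTS; apply/measurable_EFinP; exact: measurable_beta_weight.
move=> t tD; rewrite lee_fin.
have [tJ|] := pselect (forall l, J l (tnth t l)); last first.
  move=> /existsNP[l tl]; rewrite (bigD1 l)//= {1}/g indicE memNset// mulr0 mul0r.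
  exact: beta_weight_ge0.
rewrite -[leLHS]mulr1; apply: ler_pM => //.
- by rewrite prodr_ge0.
- apply: ler_prod => l _; rewrite g0/= /g indicE mem_set// mulr1.
  apply: laguerre_weight_ge; have := tJ l; rewrite /J /= in_itv/= => /andP[h ->].
  by rewrite andbT (le_trans _ h)// ler1n addn1.
apply: (big_ind (fun x : R => 1 <= x)) => // [x y x1 y1|j _]; first exact: mulr_ege1.
apply: (big_ind (fun x : R => 1 <= x)) => // [x y x1 y1|k jk]; first exact: mulr_ege1.
rewrite -(powRr0 `|(tnth t k : R) - tnth t j|); apply: ler_powR; last by rewrite mulr_ge0// ltW.
rewrite (le_trans _ (ler_norm _))//.
have := tJ k; have := tJ j; rewrite /J /= !in_itv/= => /andP[_ tj] /andP[tk _].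
have : (2 * j + 2)%:R + 1 <= (2 * k + 1)%:R :> R.
  by rewrite natr1 ler_nat; lia.
lra.
Qed.

Let E N := @beta_average R laguerre_weight kappa N.

Lemma eq_beta_average N (f g : T N -> R) :
  (forall t, pos_orthant t -> f t = g t) -> E f = E g.
Proof.
move=> fg; congr (_ / _); apply: eq_Rintegral => t; rewrite inE => tD.
by rewrite fg.
Qed.

Lemma beta_average1 N : E (fun _ : T N => 1) = 1.
Proof.
rewrite /E /beta_average; under eq_Rintegral do rewrite mul1r.
by rewrite divff// gt_eqF// partition_function_gt0.
Qed.

Lemma beta_averageD N (f g : T N -> R) : tempered f -> tempered g ->
  E (fun t => f t + g t) = E f + E g.
Proof.
move=> tf tg; rewrite /E /beta_average -mulrDl; congr (_ / _).
under eq_Rintegral do rewrite mulrDl.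
by have mDN := @measurable_pos_orthant R N; rewrite RintegralD//; exact: integrable_tempered.
Qed.

Lemma beta_averageZ N (r : R) (f : T N -> R) : tempered f ->
  E (fun t => r * f t) = r * E f.
Proof.
move=> tf; rewrite /E /beta_average mulrA; congr (_ / _).
under eq_Rintegral do rewrite -mulrA.
by have mDN := @measurable_pos_orthant R N; rewrite RintegralZl//; exact: integrable_tempered.
Qed.

Lemma beta_average_sum N (I : Type) (s : seq I) (f : I -> T N -> R) :
  (forall i, tempered (f i)) ->
  E (fun t => \sum_(i <- s) f i t) = \sum_(i <- s) E (f i).
Proof.
move=> tf; elim: s => [|i s IH].
  rewrite big_nil; under [X in E X]eq_fun do rewrite big_nil -(mul0r 0).
  by rewrite beta_averageZ ?mul0r//; exact: tempered_cst.
rewrite big_cons -IH -beta_averageD//; last exact: tempered_sum.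
by apply: eq_beta_average => t _; rewrite big_cons.
Qed.

End laguerre.

(** * The loop equation of the Laguerre ensemble *)

Section expansion.
Context {R : realType}.
Local Notation T N := (N.-tuple (measurableTypeR R)).

(** The flow parameter runs through a sequence because dominated convergence is applied to
    sequences. *)
Definition eps (n : nat) : R := n.+1%:R^-1.

Lemma eps_gt0 n : 0 < eps n. Proof. by rewrite invr_gt0 ltr0n. Qed.

Lemma eps_le1 n : eps n <= 1. Proof. by rewrite invf_le1 ?ler1n ?ltr0n. Qed.

Lemma eps_cvg0 : eps n @[n --> \oo] --> 0.
Proof. exact: cvg_harmonic. Qed.

Lemma tempered_norm N (f : T N -> R) : tempered f -> tempered (fun t => `|f t|).
Proof.
move=> [mf [K Kf]]; split; first exact: measurableT_comp.
by exists K => t tD; rewrite normr_id Kf.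
Qed.

Lemma le_tempered N (f g : T N -> R) : measurable_fun setT f -> tempered g ->
  (forall t, pos_orthant t -> `|f t| <= g t) -> tempered f.
Proof.
move=> mf [_ [K Kg]] fg; split=> //; exists K => t tD.
by rewrite (le_trans (fg t tD))// (le_trans (ler_norm _))// Kg.
Qed.

(* u n = u0 + eps n * u1 + o(eps n) pointwise, with a remainder that is
   dominated uniformly in n. *)
Definition expansion N (u : nat -> T N -> R) (u0 u1 : T N -> R) :=
  [/\ tempered u0, tempered u1, forall n, measurable_fun setT (u n),
    exists2 B, tempered B &
      forall n t, pos_orthant t -> `|u n t - u0 t| <= eps n * B t
  & forall t, pos_orthant t -> (u n t - u0 t) / eps n @[n --> \oo] --> u1 t].

Lemma tempered_expansion N (u : nat -> T N -> R) u0 u1 n :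
  expansion u u0 u1 -> tempered (u n).
Proof.
move=> [tu0 _ mu [B tB uB] _].
apply: (@le_tempered _ _ (fun t => `|u0 t| + `|B t|)) => //.
  by apply: temperedD; exact: tempered_norm.
move=> t tD; rewrite -{1}(subrK (u0 t) (u n t)) addrC (le_trans (ler_normD _ _))// lerD2l.
rewrite (le_trans (uB n t tD))// (le_trans (ler_norm _))// normrM.
by rewrite ler_piMl// gtr0_norm ?eps_gt0// eps_le1.
Qed.

Lemma expansion_cst N (f : T N -> R) : tempered f ->
  expansion (fun _ => f) f (fun=> 0).
Proof.
move=> tf; split=> //.
- exact: tempered_cst.
- by move=> _; case: tf.
- exists (fun=> 0); first exact: tempered_cst.
  by move=> n t _; rewrite subrr normr0 mulr0.
- by move=> t _; under eq_fun do rewrite subrr mul0r; exact: cvg_cst.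
Qed.

Lemma expansionD N (u v : nat -> T N -> R) u0 u1 v0 v1 :
  expansion u u0 u1 -> expansion v v0 v1 ->
  expansion (fun n t => u n t + v n t) (fun t => u0 t + v0 t) (fun t => u1 t + v1 t).
Proof.
move=> [tu0 tu1 mu [B tB uB] ul] [tv0 tv1 mv [C tC vC] vl]; split.
- exact: temperedD.
- exact: temperedD.
- by move=> n; exact: measurable_funD.
- exists (fun t => B t + C t); first exact: temperedD.
  move=> n t tD; rewrite opprD addrACA (le_trans (ler_normD _ _))// mulrDr.
  by apply: lerD; [exact: uB|exact: vC].
- move=> t tD; under eq_fun do rewrite opprD addrACA mulrDl.
  by apply: cvgD; [exact: ul|exact: vl].
Qed.

Lemma expansionM N (u v : nat -> T N -> R) u0 u1 v0 v1 :
  expansion u u0 u1 -> expansion v v0 v1 ->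
  expansion (fun n t => u n t * v n t) (fun t => u0 t * v0 t)
    (fun t => u1 t * v0 t + u0 t * v1 t).
Proof.
move=> [tu0 tu1 mu [B tB uB] ul] [tv0 tv1 mv [C tC vC] vl].
have split_uv n t : u n t * v n t - u0 t * v0 t =
    (u n t - u0 t) * v0 t + u0 t * (v n t - v0 t) + (u n t - u0 t) * (v n t - v0 t).
  by ring.
split.
- exact: temperedM.
- by apply: temperedD; exact: temperedM.
- by move=> n; exact: measurable_funM.
- exists (fun t => B t * `|v0 t| + `|u0 t| * C t + B t * C t).
    apply: temperedD; last exact: temperedM.
    by apply: temperedD; apply: temperedM => //; exact: tempered_norm.
  move=> n t tD; rewrite split_uv.
  have hu := uB n t tD; have hv := vC n t tD.
  apply: (le_trans (ler_normD _ _)); rewrite [leRHS]mulrDr; apply: lerD.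
    apply: (le_trans (ler_normD _ _)); rewrite [leRHS]mulrDr !normrM; apply: lerD.
      by rewrite mulrA ler_wpM2r.
    by rewrite mulrCA ler_wpM2l.
  have e0 := ltW (eps_gt0 n).
  have C0 : 0 <= eps n * C t by exact: le_trans (normr_ge0 _) hv.
  have {}C0 : 0 <= C t by rewrite pmulr_rge0 ?eps_gt0 in C0.
  rewrite normrM mulrA; apply: ler_pM => //; apply: (le_trans hv).
  by rewrite ler_piMl// eps_le1.
- move=> t tD.
  have v0l : (fun n => v n t - v0 t) @ \oo --> (0 : R).
    rewrite -(mul0r (v1 t)).
    rewrite (_ : (fun n => v n t - v0 t) = (fun n => eps n * ((v n t - v0 t) / eps n))).
      by apply: cvgM; [exact: eps_cvg0|exact: vl].
    by apply/funext => n; rewrite mulrCA divff ?mulr1// gt_eqF// eps_gt0.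
  have -> : u1 t * v0 t + u0 t * v1 t = u1 t * v0 t + u0 t * v1 t + u1 t * 0.
    by rewrite mulr0 addr0.
  rewrite (_ : (fun n => _) = (fun n => (u n t - u0 t) / eps n * v0 t +
     u0 t * ((v n t - v0 t) / eps n) + (u n t - u0 t) / eps n * (v n t - v0 t))).
    apply: cvgD; first apply: cvgD.
    + by apply: cvgM; [exact: ul|exact: cvg_cst].
    + by apply: cvgM; [exact: cvg_cst|exact: vl].
    + by apply: cvgM; [exact: ul|exact: v0l].
  by apply/funext => n; rewrite split_uv !mulrDl; ring.
Qed.

Lemma expansion_ext N (u u' : nat -> T N -> R) u0 u0' u1 u1' :
  expansion u u0 u1 -> (forall n t, u n t = u' n t) ->
  (forall t, u0 t = u0' t) -> (forall t, u1 t = u1' t) -> expansion u' u0' u1'.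
Proof.
move=> e hu h0 h1.
have -> : u' = u by apply/funext => n; apply/funext => t; rewrite hu.
have -> : u0' = u0 by apply/funext => t; rewrite h0.
by have -> : u1' = u1 by apply/funext => t; rewrite h1.
Qed.

Lemma expansion_sum N (I : Type) (s : seq I) (u : I -> nat -> T N -> R) u0 u1 :
  (forall i, expansion (u i) (u0 i) (u1 i)) ->
  expansion (fun n t => \sum_(i <- s) u i n t) (fun t => \sum_(i <- s) u0 i t)
    (fun t => \sum_(i <- s) u1 i t).
Proof.
move=> e; elim: s => [|i s IH].
  by apply: (expansion_ext (expansion_cst (tempered_cst N 0))) => * /=; rewrite ?big_nil.
by apply: (expansion_ext (expansionD (e i) IH)) => * /=; rewrite ?big_cons.
Qed.

Lemma expansion_prod1 N (I : Type) (s : seq I) (u : I -> nat -> T N -> R) u1 :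
  (forall i, expansion (u i) (fun=> 1) (u1 i)) ->
  expansion (fun n t => \prod_(i <- s) u i n t) (fun=> 1)
    (fun t => \sum_(i <- s) u1 i t).
Proof.
move=> e; elim: s => [|i s IH].
  by apply: (expansion_ext (expansion_cst (tempered_cst N 1))) => * /=; rewrite ?big_nil.
by apply: (expansion_ext (expansionM (e i) IH)) => * /=; rewrite ?big_cons ?mulr1 ?mul1r.
Qed.

Lemma cvg_derive_eps (f : R -> R) (d : R) : is_derive (0 : R) (1 : R) f d ->
  (f (eps n) - f 0) / eps n @[n --> \oo] --> d.
Proof.
move=> [df <-].
have e0 : eps n @[n --> \oo] --> (0 : R)^'.
  move=> A nA.
  have h : \forall n \near \oo, eps n != 0 -> A (eps n) by exact: eps_cvg0 nA.
  rewrite /nbhs /=; apply: filterS h => n; apply.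
  exact: lt0r_neq0 (eps_gt0 n).
have := cvg_comp _ _ e0 df.
apply: cvg_trans; apply: near_eq_cvg; apply: nearW => n /=.
by rewrite addr0 /GRing.scale /= mulr1 mulrC.
Qed.

Lemma is_derive_affine (a k x : R) : is_derive x (1 : R) (fun s => a + s * k) k.
Proof.
rewrite (_ : (fun s => a + s * k) = cst a + (k \*: id)); last first.
  by apply/funext => s; rewrite [s * k]mulrC.
have h := is_deriveD (is_derive_cst a x (1 : R)) (is_deriveZ k (is_derive_id x (1 : R))).
by apply: is_derive_eq h _; rewrite add0r /GRing.scale /= mulr1.
Qed.

(** Nonnegativity of [x] keeps the remainder tempered, through 0 <= 1 - exp(-y) <= y for y >= 0. *)
Lemma expansion_expR N (x : T N -> R) : tempered x ->
  (forall t, pos_orthant t -> 0 <= x t) ->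
  expansion (fun n t => expR (- (eps n * x t))) (fun=> 1) (fun t => - x t).
Proof.
move=> tx x0; have mx : measurable_fun setT x by case: tx.
split.
- exact: tempered_cst.
- by rewrite (_ : (fun t => - x t) = (fun t => -1 * x t));
    [exact: temperedZ|apply/funext => t; rewrite mulN1r].
- move=> n; apply: measurableT_comp => //; apply: measurableT_comp => //.
  exact: measurable_funM.
- exists x => // n t tD; rewrite ler_norml.
  have := expR_ge1Dx (- (eps n * x t)).
  have : 0 <= eps n * x t by rewrite mulr_ge0 ?x0// ltW// eps_gt0.
  move=> h0; have : expR (- (eps n * x t)) <= 1 by rewrite -expR0 ler_expR oppr_le0.
  lra.
- move=> t _.
  have /cvg_derive_eps : is_derive (0 : R) (1 : R) (fun s => expR (- (s * x t))) (- x t).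
    have h := is_derive1_comp (is_derive_expR _) (is_derive_affine 0 (- x t) 0).
    rewrite (_ : (fun s => _) = expR \o (fun s => 0 + s * - x t)).
      by apply: is_derive_eq h _; rewrite mul0r addr0 expR0 mul1r.
    by apply/funext => s; rewrite /= add0r mulrN.
  by rewrite mul0r oppr0 expR0.
Qed.

Lemma expR_sub1_le (y : R) : `|expR y - 1| <= `|y| * expR `|y|.
Proof.
have [y0|y0] := leP 0 y.
  have e1 : 1 <= expR y by rewrite -expR0 ler_expR.
  rewrite (ger0_norm y0) ger0_norm ?subr_ge0//.
  have := expR_ge1Dx (- y); rewrite -(ler_pM2r (expR_gt0 y)) -expRD addNr expR0.
  lra.
have h := expR_ge1Dx y.
have e1 : expR y <= 1 by rewrite -expR0 ler_expR ltW.
rewrite ler0_norm ?subr_le0//.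
apply: (@le_trans _ _ (- y)); first lra.
by rewrite (ltr0_norm y0) ler_peMr ?oppr_ge0 ?(ltW y0)// -expR0 ler_expR oppr_ge0 ltW.
Qed.

(** With y = r ln(1 + eps x) one has |y| <= |r| eps x, and exp |y| = (1 + eps x)^|r| has polynomial
    growth, so [expR_sub1_le] bounds the remainder. *)
Lemma expansion_powR N (r : R) (x : T N -> R) : tempered x ->
  (forall t, pos_orthant t -> 0 <= x t) ->
  expansion (fun n t => (1 + eps n * x t) `^ r) (fun=> 1) (fun t => r * x t).
Proof.
move=> tx x0; have mx : measurable_fun setT x by case: tx.
have [M rM] : exists M : nat, `|r| <= M%:R.
  by exists (Num.bound `|r|); rewrite ltW// archi_boundP.
split.
- exact: tempered_cst.
- exact: temperedZ.
- move=> n; apply: (measurableT_comp (measurable_powR _)); apply: measurable_funD => //.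
  exact: measurable_funM.
- exists (fun t => `|r| * (x t * (1 + x t) ^+ M)).
    apply: temperedZ; apply: temperedM => //; apply: temperedX; apply: temperedD => //.
    exact: tempered_cst.
  move=> n t tD.
  have ex0 : 0 <= eps n * x t by rewrite mulr_ge0 ?x0// ltW// eps_gt0.
  have ex1 : 0 < 1 + eps n * x t by lra.
  have ln0 : 0 <= ln (1 + eps n * x t) by rewrite ln_ge0// lerDl.
  have lnle : ln (1 + eps n * x t) <= eps n * x t.
    by rewrite -ler_expR lnK ?posrE// expR_ge1Dx.
  rewrite {1}/powR gt_eqF//; apply: (le_trans (expR_sub1_le _)).
  rewrite normrM (ger0_norm ln0).
  have -> : expR (`|r| * ln (1 + eps n * x t)) = (1 + eps n * x t) `^ `|r|.
    by rewrite /powR gt_eqF.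
  have -> : eps n * (`|r| * (x t * (1 + x t) ^+ M)) =
    `|r| * (eps n * x t * (1 + x t) ^+ M) by ring.
  rewrite -[leLHS]mulrA; apply: ler_wpM2l => //; apply: ler_pM => //.
    exact: powR_ge0.
  apply: (@le_trans _ _ ((1 + eps n * x t) ^+ M)).
    by rewrite -powR_mulrn ?(ltW ex1)//; apply: ler_powR => //; rewrite lerDl.
  apply: lerXn2r; rewrite ?nnegrE ?(ltW ex1) ?addr_ge0 ?x0// lerD2l ler_piMl ?x0//.
  exact: eps_le1.
- move=> t _.
  have /cvg_derive_eps : is_derive (0 : R) (1 : R) (fun s => (1 + s * x t) `^ r) (r * x t).
    have h1 : is_derive (1 + 0 * x t) (1 : R) (fun y => y `^ r) r.
      have := is_derive1_powR r (ltr01 : 0 < 1 :> R).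
      by rewrite powR1 mulr1 mul0r addr0.
    have h := @is_derive1_comp _ (fun y : R => y `^ r) (fun s => 1 + s * x t) 0 _ _
      h1 (is_derive_affine 1 (x t) 0).
    exact: h.
  by rewrite mul0r addr0 powR1.
Qed.

End expansion.

(** * First-order invariance of averages under the flow *)

Section loop_equation.
Context {R : realType}.
Local Notation leb := (@lebesgue_measure R).
Local Notation T N := (N.-tuple (measurableTypeR R)).
Variables (b c kappa : R).
Hypotheses (b_gt : -1 < b) (c_gt0 : 0 < c) (kappa_gt0 : 0 < kappa).

Let W N := @beta_weight R (laguerre_weight b c) kappa N.
Let E N := @beta_average R (laguerre_weight b c) kappa N.

Let integralE N (f : T N -> R) : tempered f ->
  (\int[lebesgue_tuple N]_(t in @pos_orthant R N) (f t * W t)%:E =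
   (E f * \int[lebesgue_tuple N]_(t in @pos_orthant R N) W t)%:E)%E.
Proof.
move=> tf; have Z0 := partition_function_gt0 b_gt c_gt0 kappa_gt0 N.
rewrite /E /beta_average divfK ?gt_eqF// /Rintegral fineK//.
have mD := @measurable_pos_orthant R N.
exact: (integrable_fin_num mD (integrable_tempered b_gt c_gt0 kappa_gt0 tf)).
Qed.

(** The difference quotients all have average zero, and dominated convergence carries this over to
    their limit. *)
Lemma expansion_average0 N (u : nat -> T N -> R) f u1 : expansion u f u1 ->
  (forall n, E (u n) = E f) -> E u1 = 0.
Proof.
move=> e uf; have [tf tu1 mu [B tB uB] ul] := e.
have tu n := tempered_expansion n e.
have mD := @measurable_pos_orthant R N.
have mW := @measurable_beta_weight R b c kappa N.
have W0 (t : T N) : 0 <= W t by exact: beta_weight_ge0.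
have tq n : tempered (fun t => (u n t - f t) / eps n : R).
  apply: temperedM; last exact: tempered_cst.
  apply: temperedD; first exact: tu.
  by under eq_fun do rewrite -mulN1r; exact: temperedZ.
pose q n (t : T N) := ((u n t - f t) / eps n * W t)%:E.
have mq n : measurable_fun (@pos_orthant R N) (q n).
  by apply: measurable_funTS; apply/measurable_EFinP; apply: measurable_funM => //; case: (tq n).
have [||||] := @dominated_convergence _ _ _ (lebesgue_tuple N) _ mD
  q (fun t => (u1 t * W t)%:E) (fun t => (B t * W t)%:E) mq.
- by apply: measurable_funTS; apply/measurable_EFinP; apply: measurable_funM => //; case: tu1.
- apply: aeW => t tD; apply/cvg_EFin; first exact: nearW.
  by apply: cvgM; [exact: ul|exact: cvg_cst].
- exact: integrable_tempered.
- apply: aeW => t n tD; rewrite /q lee_fin normrM (ger0_norm (W0 t)) ler_wpM2r//.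
  rewrite normrM normfV (gtr0_norm (eps_gt0 n)) ler_pdivrMr ?eps_gt0// mulrC.
  exact: uB.
move=> _ _ /=.
rewrite integralE// (_ : (fun n => _) = (fun=> 0%E)); last first.
  apply/funext => n; rewrite /q integralE//.
  suff -> : E (fun t => (u n t - f t) / eps n) = 0 by rewrite mul0r.
  under [X in E X]eq_fun do rewrite mulrC.
  rewrite /E beta_averageZ//; last first.
    apply: temperedD; first exact: tu.
    by under eq_fun do rewrite -mulN1r; exact: temperedZ.
  under [X in beta_average _ _ X]eq_fun do rewrite -mulN1r.
  rewrite beta_averageD//; last exact: temperedZ.
  by rewrite beta_averageZ// -/(E _) -/(E _) uf mulN1r subrr mulr0.
move=> /(cvg_lim (@ereal_hausdorff R)); rewrite lim_cst; last exact: ereal_hausdorff.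
move=> /esym/eqP.
rewrite eqe mulf_eq0 (gt_eqF (partition_function_gt0 b_gt c_gt0 kappa_gt0 N)) orbF.
by move=> /eqP.
Qed.

Lemma beta_average_substitution (phi phi' : R -> R) N (f J : T N -> R) :
  (forall x, is_derive x (1 : R) phi (phi' x)) -> continuous phi' ->
  (forall x, 0 <= x -> 0 <= phi' x) -> phi 0 = 0 ->
  (forall x y, 0 <= x -> x < y -> phi x < phi y) ->
  (forall y, 0 <= y -> exists2 x, 0 <= x & phi x = y) ->
  tempered f -> (forall t, pos_orthant t -> 0 <= f t) ->
  (forall t, pos_orthant t ->
     W (map_tuple phi t) * \prod_(l < N) phi' (tnth t l) = J t * W t) ->
  E (fun t => f (map_tuple phi t) * J t) = E f.
Proof.
move=> dphi cphi' phi'0 phi0 phi_lt phi_surj tf f0 WJ.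
have phiD (t : T N) : pos_orthant t -> pos_orthant (map_tuple phi t : T N).
  by move=> tD l; rewrite tnth_map -phi0; apply: phi_lt => //; exact: tD.
rewrite /E /beta_average; congr (_ / _); rewrite /Rintegral; congr fine.
(* The substitution rule wants an integrand nonnegative everywhere, while [f] is nonnegative on the
   orthant only. *)
transitivity (\int[lebesgue_tuple N]_(t in @pos_orthant R N) (`|f t| * W t)%:E)%E; last first.
  by apply: eq_integral => t; rewrite inE => tD; rewrite ger0_norm ?f0.
rewrite [RHS](integral_orthant_substitution dphi)//.
- apply: eq_integral => t; rewrite inE => tD /=.
  have ft := f0 _ (phiD t tD).
  rewrite (ger0_norm ft) -EFinM; congr EFin.
  by rewrite -[LHS]mulrA -[RHS]mulrA WJ.
- by move=> t; rewrite lee_fin mulr_ge0// beta_weight_ge0.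
- apply/measurable_EFinP; apply: measurable_funM; last exact: measurable_beta_weight.
  by apply: measurableT_comp => //; case: tf.
Qed.

Variable k : nat.

(* The flow [x |-> x + e x^(k+1)] multiplies [|x - y|] by [1 + e h], [h] a
   polynomial, so that no singularity of the density has to be differentiated. *)
Definition flow (e x : R) : R := x + e * x ^+ k.+1.

Definition divided_diff (x y : R) : R := \sum_(s < k.+1) x ^+ (k - s) * y ^+ s.

Lemma divided_diff_ge0 x y : 0 <= x -> 0 <= y -> 0 <= divided_diff x y.
Proof. by move=> x0 y0; rewrite sumr_ge0// => s _; rewrite mulr_ge0 ?exprn_ge0. Qed.

Lemma flowB e x y : flow e x - flow e y = (x - y) * (1 + e * divided_diff x y).
Proof.
rewrite /flow /divided_diff mulrDr mulr1 mulrCA.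
rewrite (_ : (x - y) * \sum_(s < k.+1) x ^+ (k - s) * y ^+ s = x ^+ k.+1 - y ^+ k.+1).
  by ring.
rewrite subrXX; congr (_ * _); apply: eq_bigr => s _; by rewrite subSS.
Qed.

Lemma is_derive_flow e x : is_derive x (1 : R) (flow e) (1 + e * (k.+1%:R * x ^+ k)).
Proof.
rewrite (_ : flow e = id + (e \*: (id ^+ k.+1))); last first.
  by apply/funext => y; rewrite exprfctE.
have hX := is_deriveX k.+1 (is_derive_id x (1 : R)).
have h := is_deriveD (is_derive_id x (1 : R)) (is_deriveZ e hX).
by apply: is_derive_eq h _; rewrite /GRing.scale /= mulr1.
Qed.

Lemma flow_lt e x y : 0 <= e -> 0 <= x -> x < y -> flow e x < flow e y.
Proof.
move=> e0 x0 xy; rewrite -subr_gt0 flowB mulr_gt0 ?subr_gt0//.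
have y0 : 0 <= y by rewrite (le_trans x0)// ltW.
by rewrite ltr_pwDl// mulr_ge0// divided_diff_ge0.
Qed.

(** Intermediate value theorem on [[0, y]]: the flow fixes 0 and does not decrease [y]. *)
Lemma flow_surj e y : 0 <= e -> 0 <= y -> exists2 x, 0 <= x & flow e x = y.
Proof.
move=> e0 y0.
have [||x] := @IVT _ (flow e) 0 y y y0.
- apply: continuous_subspaceT => x.
  by apply/differentiable_continuous/derivable1_diffP; have := is_derive_flow e x => -[].
- have yf : y <= flow e y by rewrite lerDl mulr_ge0// exprn_ge0.
  by rewrite /flow expr0n/= mulr0 addr0 ge_min le_max y0 yf orbT.
- by rewrite in_itv/= => /andP[x0 _] <-; exists x.
Qed.

(** The form is adapted to the expansion lemmas: the last one-particle factor is a power with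
    exponent 1, and the products over pairs are unconditional, absent pairs contributing 1. *)
Definition flow_jacobian N (e : R) (t : T N) : R :=
  (\prod_(l < N) ((1 + e * (tnth t l : R) ^+ k) `^ b *
     expR (- (e * (c * (tnth t l : R) ^+ k.+1))) *
     (1 + e * (k.+1%:R * (tnth t l : R) ^+ k)) `^ 1)) *
  \prod_(j < N) \prod_(i < N)
    (1 + e * (if (j < i)%N then divided_diff (tnth t i) (tnth t j) else 0)) `^ (2 * kappa).

Lemma beta_weight_flow N e (t : T N) : 0 <= e -> pos_orthant t ->
  W (map_tuple (flow e) t) * \prod_(l < N) (1 + e * (k.+1%:R * (tnth t l : R) ^+ k)) =
  flow_jacobian e t * W t.
Proof.
move=> e0 tD; rewrite /W /beta_weight /flow_jacobian.
have t0 l : 0 <= (tnth t l : R) by exact: ltW (tD l).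
rewrite mulrAC -big_split/= [RHS]mulrACA -!big_split/=.
apply: eq_bigr => l _; congr (_ * _).
  rewrite tnth_map /laguerre_weight.
  have p1 : 0 <= 1 + e * (tnth t l : R) ^+ k by rewrite addr_ge0// mulr_ge0// exprn_ge0.
  have p2 : 0 <= 1 + e * (k.+1%:R * (tnth t l : R) ^+ k).
    by rewrite addr_ge0// !mulr_ge0// exprn_ge0.
  have -> : flow e (tnth t l) = tnth t l * (1 + e * (tnth t l : R) ^+ k).
    by rewrite /flow exprS; ring.
  rewrite powRM// powRr1//.
  rewrite (_ : - (c * _) = - (e * (c * (tnth t l : R) ^+ k.+1)) + - (c * tnth t l)).
    by rewrite expRD; ring.
  by rewrite exprS; ring.
rewrite [LHS]big_mkcond [X in _ = _ * X]big_mkcond -big_split/=.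
apply: eq_bigr => i _.
case: ifP => ji; last by rewrite mulr0 addr0 powR1 mulr1.
rewrite !tnth_map flowB normrM powRM// mulrC; congr (_ * _).
by rewrite ger0_norm// addr_ge0// mulr_ge0// divided_diff_ge0.
Qed.

Lemma expansion_affine N (u0 x : T N -> R) : tempered u0 -> tempered x ->
  expansion (fun n t => u0 t + eps n * x t) u0 x.
Proof.
move=> t0 tx; split=> //.
- move=> n; apply: measurable_funD; first by case: t0.
  by apply: measurable_funM => //; case: tx.
- exists (fun t => `|x t|); first exact: tempered_norm.
  by move=> n t _; rewrite addrC addKr normrM gtr0_norm ?eps_gt0.
- move=> t _; rewrite (_ : (fun n => _) = (fun=> x t)); first exact: cvg_cst.
  by apply/funext => n; rewrite addrC addKr mulrAC divff ?mul1r// gt_eqF// eps_gt0.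
Qed.

Lemma expansionX N (u : nat -> T N -> R) u0 u1 p : expansion u u0 u1 ->
  expansion (fun n t => u n t ^+ p) (fun t => u0 t ^+ p)
    (fun t => p%:R * u0 t ^+ p.-1 * u1 t).
Proof.
move=> e; elim: p => [|p IH].
  by apply: (expansion_ext (expansion_cst (tempered_cst N 1))) => * /=; rewrite ?expr0 ?mul0r.
apply: (expansion_ext (expansionM e IH)) => [n t|t|t] /=; rewrite ?exprS//.
by case: p {IH} => [|p]; rewrite /= ?exprS -[in RHS]natr1; ring.
Qed.

Lemma tempered_coordX N (l : 'I_N) p : tempered (fun t : T N => (tnth t l : R) ^+ p).
Proof. by apply: temperedX; exact: tempered_coord. Qed.

Lemma expansion_power_sum N p :
  expansion (fun n (t : T N) => power_sum p (map_tuple (flow (eps n)) t))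
    (@power_sum R N p) (fun t => p%:R * power_sum (k + p) t).
Proof.
pose u (l : 'I_N) n (t : T N) := ((tnth t l : R) + eps n * (tnth t l : R) ^+ k.+1) ^+ p.
have e l : expansion (u l) (fun t => (tnth t l : R) ^+ p)
    (fun t => p%:R * (tnth t l : R) ^+ p.-1 * (tnth t l : R) ^+ k.+1).
  by apply: expansionX; apply: expansion_affine; [exact: tempered_coord|exact: tempered_coordX].
apply: (expansion_ext (expansion_sum (index_enum 'I_N) e)) => [n t|t|t] //.
  by rewrite /power_sum; apply: eq_bigr => l _; rewrite tnth_map.
rewrite /power_sum big_distrr/=; apply: eq_bigr => l _.
(* At p = 0 the truncated [p.-1] gives the wrong exponent, but the factor [p] is zero. *)
case: p {u e} => [|p]; first by rewrite !mul0r.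
by rewrite -mulrA -exprD; congr (_ * _ ^+ _); lia.
Qed.

Definition power_sums N (l : seq nat) (t : T N) : R := \prod_(p <- l) power_sum p t.

Lemma tempered_power_sums N l : tempered (@power_sums N l).
Proof. by apply: tempered_prod => p; exact: tempered_power_sum. Qed.

Lemma power_sums_cons N p l (t : T N) :
  power_sums (p :: l) t = power_sum p t * power_sums l t.
Proof. by rewrite /power_sums big_cons. Qed.

Lemma expansion_power_sums N l :
  expansion (fun n (t : T N) => power_sums l (map_tuple (flow (eps n)) t))
    (@power_sums N l) (fun t => shift_sum k (fun s => power_sums s t) l).
Proof.
elim: l => [|p l IH].
  by apply: (expansion_ext (expansion_cst (tempered_cst N 1))) => * //=; rewrite /power_sums big_nil.
apply: (expansion_ext (expansionM (expansion_power_sum N p) IH)) => [n t|t|t] /=.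
- by rewrite power_sums_cons.
- by rewrite power_sums_cons.
rewrite power_sums_cons mulrA -shift_sumZ; congr (_ + _).
by apply: eq_shift_sum => s _ _ _; rewrite power_sums_cons.
Qed.

Definition log_jacobian N (t : T N) : R :=
  \sum_(l < N) (b * (tnth t l : R) ^+ k - c * (tnth t l : R) ^+ k.+1
     + k.+1%:R * (tnth t l : R) ^+ k) +
  \sum_(j < N) \sum_(i < N)
     2 * kappa * (if (j < i)%N then divided_diff (tnth t i) (tnth t j) else 0).

Lemma expansion_jacobian N :
  expansion (fun n (t : T N) => flow_jacobian (eps n) t) (fun=> 1) (@log_jacobian N).
Proof.
have tX := tempered_coordX.
have tD0 (t : T N) l p : pos_orthant t -> 0 <= (tnth t l : R) ^+ p.
  by move=> tD; rewrite exprn_ge0// ltW//; exact: tD.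
pose u1 (l : 'I_N) n (t : T N) := (1 + eps n * (tnth t l : R) ^+ k) `^ b *
     expR (- (eps n * (c * (tnth t l : R) ^+ k.+1))) *
     (1 + eps n * (k.+1%:R * (tnth t l : R) ^+ k)) `^ 1.
have e1 l : expansion (u1 l) (fun=> 1) (fun t => b * (tnth t l : R) ^+ k
    - c * (tnth t l : R) ^+ k.+1 + k.+1%:R * (tnth t l : R) ^+ k).
  have ea := expansion_powR b (tX N l k) (fun t => tD0 t l k).
  have eb := @expansion_expR _ _ (fun t => c * (tnth t l : R) ^+ k.+1)
    (temperedZ c (tX N l k.+1)) (fun t tD => mulr_ge0 (ltW c_gt0) (tD0 t l k.+1 tD)).
  have ec := @expansion_powR _ _ 1 (fun t => k.+1%:R * (tnth t l : R) ^+ k)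
    (temperedZ _ (tX N l k)) (fun t tD => mulr_ge0 (ler0n _ _) (tD0 t l k tD)).
  apply: (expansion_ext (expansionM (expansionM ea eb) ec)) => [//|t|t] /=;
    by rewrite ?mulr1 ?mul1r.
pose h (j i : 'I_N) (t : T N) : R :=
  if (j < i)%N then divided_diff (tnth t i) (tnth t j) else 0.
have th j i : tempered (h j i).
  rewrite /h; case: (j < i)%N; last exact: tempered_cst.
  by apply: tempered_sum => s; apply: temperedM; exact: tX.
have h0 j i t : pos_orthant t -> 0 <= h j i t.
  move=> tD; rewrite /h; case: ifP => // _; apply: divided_diff_ge0; apply: ltW; exact: tD.
have e2 j i := expansion_powR (2 * kappa) (th j i) (h0 j i).
have e3 j := expansion_prod1 (index_enum 'I_N) (e2 j).
apply: (expansion_ext (expansionM (expansion_prod1 (index_enum 'I_N) e1)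
  (expansion_prod1 (index_enum 'I_N) e3))) => [//|t|t] /=;
  by rewrite ?mulr1 ?mul1r.
Qed.

(** The diagonal left over by this symmetrisation is the origin of [1 - kappa] in the one-particle
    coefficient. *)
Lemma sum_lt_sym (N : nat) (a : 'I_N -> 'I_N -> R) : (forall i j, a i j = a j i) ->
  2 * (\sum_(j < N) \sum_(i < N) if (j < i)%N then a i j else 0) =
  \sum_(j < N) \sum_(i < N) a i j - \sum_(j < N) a j j.
Proof.
move=> asym; set S := \sum_(j < N) _.
have S' : S = \sum_(j < N) \sum_(i < N) if (i < j)%N then a i j else 0.
  rewrite /S exchange_big; apply: eq_bigr => j _; apply: eq_bigr => i _.
  by rewrite asym.
have D : \sum_(j < N) a j j = \sum_(j < N) \sum_(i < N) if i == j then a i j else 0.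
  by apply: eq_bigr => j _; rewrite -big_mkcond big_pred1_eq.
rewrite mulr_natl mulr2n {2}S' D /S -sumrB -big_split/=; apply: eq_bigr => j _.
rewrite -sumrB -big_split/=; apply: eq_bigr => i _.
case: (ltngtP i j) => [ij|ji|ij].
- by rewrite -(inj_eq val_inj) ltn_eqF// subr0 add0r.
- by rewrite -(inj_eq val_inj) gtn_eqF// subr0 addr0.
- by rewrite (val_inj ij) eqxx subrr addr0.
Qed.

Lemma log_jacobianE N (t : T N) :
  log_jacobian t = (k.+1%:R * (1 - kappa) + b) * power_sum k t
    - c * power_sum k.+1 t
    + kappa * \sum_(s < k.+1) power_sum s t * power_sum (k - s) t.
Proof.
rewrite /log_jacobian.
have -> : \sum_(j < N) \sum_(i < N)
     2 * kappa * (if (j < i)%N then divided_diff (tnth t i) (tnth t j) else 0) =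
   kappa * (2 * (\sum_(j < N) \sum_(i < N)
     if (j < i)%N then divided_diff (tnth t i) (tnth t j) else 0)).
  rewrite mulrA big_distrr/=; apply: eq_bigr => j _.
  by rewrite big_distrr/=; apply: eq_bigr => i _; rewrite [kappa * 2]mulrC.
rewrite (@sum_lt_sym N (fun i j => divided_diff (tnth t i) (tnth t j))); last first.
  move=> i j; rewrite /divided_diff (reindex_inj rev_ord_inj)/=.
  apply: eq_bigr => s _; rewrite subSS mulrC; congr (_ * _ ^+ _).
  by rewrite subKn// -ltnS.
have -> : \sum_(j < N) \sum_(i < N) divided_diff (tnth t i) (tnth t j) =
    \sum_(s < k.+1) power_sum s t * power_sum (k - s) t.
  rewrite /divided_diff; under eq_bigr do rewrite exchange_big/=.
  rewrite exchange_big/=; apply: eq_bigr => s _.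
  rewrite /power_sum big_distrl/=; apply: eq_bigr => j _.
  by rewrite -big_distrl/= mulrC.
have -> : \sum_(j < N) divided_diff (tnth t j) (tnth t j) = k.+1%:R * power_sum k t.
  rewrite /power_sum big_distrr/=; apply: eq_bigr => j _; rewrite /divided_diff.
  rewrite (eq_bigr (fun=> (tnth t j : R) ^+ k)); first by rewrite sumr_const card_ord mulr_natl.
  by move=> s _; rewrite -exprD subnK// -ltnS.
have -> : \sum_(l < N) (b * (tnth t l : R) ^+ k - c * (tnth t l : R) ^+ k.+1
     + k.+1%:R * (tnth t l : R) ^+ k) =
   b * power_sum k t - c * power_sum k.+1 t + k.+1%:R * power_sum k t.
  by rewrite /power_sum !big_distrr/= -sumrB -big_split.
ring.
Qed.

Definition moment N l := E (@power_sums N l).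

Let tPS := tempered_power_sums.

Lemma beta_average_shift_sum N l (G : seq nat -> T N -> R) :
  (forall s, tempered (G s)) ->
  tempered (fun t => shift_sum k (G^~ t) l) /\
  E (fun t => shift_sum k (G^~ t) l) = shift_sum k (fun s => E (G s)) l.
Proof.
elim: l G => [|x l IH] G tG /=.
  split; first exact: tempered_cst.
  under [X in E X]eq_fun do rewrite -(mul0r 1).
  by rewrite /E beta_averageZ ?mul0r//; exact: tempered_cst.
have [tS ES] := IH (fun s => G (x :: s)) (fun s => tG _).
split; first by apply: temperedD => //; exact: temperedZ.
rewrite /E beta_averageD//; last exact: temperedZ.
by rewrite beta_averageZ//; congr (_ + _); exact: ES.
Qed.

(** The first-order term of the transported power sums times the Jacobian has average zero; solving
    for the moment of highest degree gives the equation. *)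
Lemma moment_loop_step N l :
  c * moment N (k.+1 :: l) = (k.+1%:R * (1 - kappa) + b) * moment N (k :: l)
   + kappa * (\sum_(s < k.+1) moment N [:: val s, (k - s)%N & l])
   + shift_sum k (moment N) l.
Proof.
have e : expansion (fun n (t : T N) =>
    power_sums l (map_tuple (flow (eps n)) t) * flow_jacobian (eps n) t)
    (@power_sums N l)
    (fun t => shift_sum k (fun s => power_sums s t) l + power_sums l t * log_jacobian t).
  apply: (expansion_ext (expansionM (expansion_power_sums N l) (expansion_jacobian N)))
    => [//|t|t] /=; by rewrite mulr1.
have [tS ES] := @beta_average_shift_sum N l (@power_sums N) (@tPS N).
have := expansion_average0 e.
rewrite (_ : (fun t => shift_sum k (fun s => power_sums s t) l + power_sums l t * log_jacobian t) =
  (fun t => shift_sum k (fun s => power_sums s t) l +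
    ((k.+1%:R * (1 - kappa) + b) * power_sums (k :: l) t +
     (- c * power_sums (k.+1 :: l) t +
      kappa * \sum_(s < k.+1) power_sums [:: val s, (k - s)%N & l] t)))); last first.
  apply/funext => t; rewrite log_jacobianE !power_sums_cons; congr (_ + _).
  under [in RHS]eq_bigr do rewrite !power_sums_cons mulrA.
  by rewrite -[in RHS]big_distrl/=; ring.
rewrite /E !beta_averageD ?beta_averageZ ?beta_average_sum//;
  try by do ?[exact: tPS|exact: tS|apply: temperedD|apply: temperedZ|apply: tempered_sum].
have {}ES : beta_average (laguerre_weight b c) kappa
    (fun t : T N => shift_sum k (fun s => power_sums s t) l) =
  shift_sum k (moment N) l := ES.
rewrite ES => h.
suff h' : shift_sum k (moment N) l +
    ((k.+1%:R * (1 - kappa) + b) * moment N (k :: l) + (- c * moment N (k.+1 :: l) +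
     kappa * \sum_(s < k.+1) moment N [:: val s, (k - s)%N & l])) = 0.
  by apply/eqP; rewrite -subr_eq0; apply/eqP; rewrite -[RHS]oppr0 -[X in _ = - X]h'; ring.
(* It remains to check that the average is invariant for each flow time [eps n]. *)
apply: h.
move=> n; apply: (@beta_average_substitution (flow (eps n))
    (fun x => 1 + eps n * (k.+1%:R * x ^+ k))) => //.
- exact: is_derive_flow.
- move=> x; apply: cvgD; first exact: cvg_cst.
  apply: cvgM; first exact: cvg_cst.
  by apply: cvgM; [exact: cvg_cst|exact: exprn_continuous].
- by move=> x x0; rewrite addr_ge0// !mulr_ge0 ?exprn_ge0// ltW// eps_gt0.
- by rewrite /flow expr0n mulr0 addr0.
- by move=> x y; apply: flow_lt; rewrite ltW// eps_gt0.
- by move=> y; apply: flow_surj; rewrite ltW// eps_gt0.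
- move=> t tD; rewrite prodr_ge0// => p _; rewrite sumr_ge0// => j _.
  by rewrite exprn_ge0// ltW//; exact: tD.
- by move=> t tD; rewrite beta_weight_flow// ltW// eps_gt0.
Qed.

End loop_equation.

(** * Leading coefficients and duality *)

Section bivariate.
Variable R : realType.
Implicit Types P Q : {poly {poly R}}.

Lemma poly_inf_roots_eq0 (S : idomainType) (p : {poly S}) (f : nat -> S) :
  injective f -> (forall i, root p (f i)) -> p = 0.
Proof.
move=> finj pf; apply/eqP/negPn/negP => p0.
have := @max_poly_roots _ p (mkseq f (size p)) p0.
rewrite size_mkseq ltnn mkseq_uniq// => /(_ _ isT) h.
by apply: notF; apply: h; apply/allP => _ /mapP[i _ ->].
Qed.

(** The grid lies in both parameter ranges, N >= 1 with a >= 0 and alpha > 0 with a > -1. Each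
    variable in turn has infinitely many roots over an integral domain. *)
Lemma bivariate_eq P Q :
  (forall i j : nat, P.[i.+1%:R, j%:R] = Q.[i.+1%:R, j%:R]) -> P = Q.
Proof.
move=> PQ; apply/eqP; rewrite -subr_eq0; apply/eqP.
apply: (@poly_inf_roots_eq0 _ _ (fun i => (i.+1%:R : R)%:P)).
  by move=> i j /polyC_inj/eqP; rewrite eqr_nat eqSS => /eqP.
move=> i; apply/rootP.
apply: (@poly_inf_roots_eq0 _ _ (fun j => j%:R : R)).
  by move=> k j /eqP; rewrite eqr_nat => /eqP.
by move=> j; apply/rootP; rewrite !hornerE PQ subrr.
Qed.

(** This is [P.[x, y]], written as a composite of ring morphisms for [cumulant_loop_rmorph]. *)
Definition eval2 (x y : R) : {poly {poly R}} -> R :=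
  horner_eval y \o horner_eval x%:P.

End bivariate.

(** * The two limits and the duality of the limiting recursions *)

Section limits.
Variable R : realType.
Implicit Types (a alpha kappa : R) (n : nat).

Lemma exponents_cons n (p : 'I_n -> nat) : (0 < n)%N ->
  exists x l, map p (enum 'I_n) = x :: l.
Proof.
case: n p => [//|n] p _; case E : (enum 'I_n.+1) => [|i s].
  by have := size_enum_ord n.+1; rewrite E.
by exists (p i), (map p s).
Qed.

(** The loop equation divided by [c]. A single [K] serves all [n], as the recursion mixes cumulants
    of different orders. *)
Lemma laguerre_cumulants (b c kappa : R) N : -1 < b -> 0 < c -> 0 < kappa ->
  exists K : seq nat -> R,
    cumulant_loop (fun k => c^-1 * (k.+1%:R * (1 - kappa) + b))
      (c^-1 * kappa) (c^-1 * kappa) c^-1 N%:R K /\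
    forall n (p : 'I_n -> nat), (0 < n)%N ->
      mixed_cumulant (laguerre_weight b c) kappa N p = K (map p (enum 'I_n)).
Proof.
move=> b1 c0 k0; pose M := moment b c kappa N.
have M1 : M [::] = 1.
  rewrite -(beta_average1 b1 c0 k0 N); congr beta_average.
  by apply/funext => t; rewrite /power_sums big_nil.
have [K MK] := cumulants_ofE M1.
exists K; split.
  apply: moment_cumulant_loop M1 MK _; split=> [l|k l].
    rewrite -(beta_averageZ b1 c0 k0)//; last exact: tempered_power_sums.
    congr beta_average; apply/funext => t; rewrite power_sums_cons; congr (_ * _).
    by rewrite /power_sum; under eq_bigr do rewrite expr0; rewrite sumr_const card_ord.
  have := moment_loop_step b1 c0 k0 k N l; rewrite -/M => h.
  by rewrite -!mulrA -!mulrDr -h mulKf// gt_eqF.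
move=> n p n0; rewrite /mixed_cumulant /joint_cumulant.
case E : (enum 'I_n) => [|i s]; first by have := size_enum_ord n; rewrite E => n_0; rewrite -n_0 in n0.
pose m (B : {set 'I_n}) := beta_average (laguerre_weight b c) kappa
  (fun t : N.-tuple (measurableTypeR R) => \prod_(i in B) power_sum (p i) t).
have Mm l : uniq l -> M (map p l) = m [set j in l]%SET.
  move=> ul; congr beta_average; apply/funext => t.
  rewrite /power_sums big_map big_uniq//; apply: eq_bigl => j.
  by rewrite inE.
have uis : uniq (i :: s) by rewrite -E enum_uniq.
rewrite -(partition_cumulantE M1 MK Mm uis) -E.
rewrite (_ : [set y in enum 'I_n]%SET = [set: 'I_n]%SET)//.
by apply/setP => j; rewrite !inE mem_enum.
Qed.

Definition low_loop (x y : R) (K : seq nat -> R) :=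
  cumulant_loop (fun k => y - k.+1%:R) 0 1 1 x K.

Definition high_loop (x y : R) (K : seq nat -> R) :=
  cumulant_loop (fun k => k.+1%:R + y) 0 x 1 1 K.

(* In P.[x, y] the outer variable stands for N, resp. alpha, and the inner one
   for a. *)
Lemma low_poly_exists : exists K : seq nat -> {poly {poly R}},
  forall x y : R, low_loop x y (eval2 x y \o K).
Proof.
have [K KL] := cumulant_loop_exists
  (fun k => ('X : {poly R})%:P - k.+1%:R : {poly {poly R}}) 1 'X.
exists K => x y; have := cumulant_loop_rmorph (horner_eval y \o horner_eval x%:P) KL.
rewrite rmorph0 !rmorph1 /low_loop.
rewrite (_ : _ \o _ = (fun k => y - k.+1%:R)); last first.
  by apply/funext => k /=; rewrite !rmorphB !rmorph_nat /= /horner_eval !hornerE.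
by rewrite /= /horner_eval !hornerE.
Qed.

Lemma high_poly_exists : exists K : seq nat -> {poly {poly R}},
  forall x y : R, high_loop x y (eval2 x y \o K).
Proof.
have [K KL] := cumulant_loop_exists
  (fun k => k.+1%:R + ('X : {poly R})%:P : {poly {poly R}}) 'X 1.
exists K => x y; have := cumulant_loop_rmorph (horner_eval y \o horner_eval x%:P) KL.
rewrite rmorph0 !rmorph1 /high_loop.
rewrite (_ : _ \o _ = (fun k => k.+1%:R + y)); last first.
  by apply/funext => k /=; rewrite !rmorphD !rmorph_nat /= /horner_eval !hornerE.
by rewrite /= /horner_eval !hornerE.
Qed.

(** A sign per unit of exponent turns k + 1 - y into y - (k + 1), and a second sign per letter
    restores the transport term. The factor [- x] then sets the quadratic coefficient to 1 and the
    particle number to [x]. *)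
Lemma low_high_loop (x y : R) K : high_loop (- x) (- y) K ->
  low_loop x y (fun l => - x * (bigrading (-1) (-1) l * K l)).
Proof.
by apply: cumulant_loop_scale => [k||||]; ring.
Qed.

Lemma low_cumulant_cvg N a n (p : 'I_n -> nat) (K : seq nat -> R) :
  (0 < N)%N -> 0 <= a -> (0 < n)%N -> low_loop N%:R a K ->
  kappa ^+ n.-1 * mixed_cumulant (laguerre_low_weight kappa a) kappa N p
    @[kappa --> +oo] --> K (map p (enum 'I_n)).
Proof.
move=> N0 a0 n0 KL.
(* Made total in kappa, with a dummy value when kappa <= 0, so that [choice] yields a family. *)
have ex kappa : exists K, 0 < kappa ->
    cumulant_loop (fun k => kappa^-1 * (k.+1%:R * (1 - kappa) + kappa * a))
      (kappa^-1 * kappa) (kappa^-1 * kappa) kappa^-1 N%:R K /\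
    forall n (p : 'I_n -> nat), (0 < n)%N ->
      mixed_cumulant (laguerre_weight (kappa * a) kappa) kappa N p = K (map p (enum 'I_n)).
  have [k0|k0] := ltP 0 kappa; last by exists (fun=> 0).
  have [|K' HK'] := @laguerre_cumulants (kappa * a) kappa kappa N _ k0 k0; last by exists K'.
  by rewrite (lt_le_trans (ltrN10 R))// mulr_ge0// ltW.
have [K' HK'] := choice ex.
(* On n letters this is kappa^(n-1) times the cumulant. The coefficients become b1 = 1/kappa, which
   tends to 0, and b2 = c = 1. *)
pose m kappa l := kappa^-1 * (bigrading kappa 1 l * K' kappa l).
have cV : kappa^-1 @[kappa --> +oo] --> (0 : R).
  by apply: (@gtr0_cvgV0 _ _ _ _ id _).2; [exact: nbhs_pinfty_gt|exact: cvg_id].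
have mcvg : forall x l, m kappa (x :: l) @[kappa --> +oo] --> K (x :: l).
  apply: (@cumulant_loop_cvg _ _ _ _
    (fun kappa k => k.+1%:R * kappa^-1 - k.+1%:R + a) (fun kappa => kappa^-1)
    (fun=> 1) (fun=> 1) (fun=> N%:R) m (fun k => a - k.+1%:R) 0 1 1 N%:R) => //.
  - near=> kappa; have k0 : 0 < kappa by near: kappa; exact: nbhs_pinfty_gt.
    have [HL _] := HK' kappa k0.
    have kn0 : kappa != 0 by rewrite gt_eqF.
    by apply: cumulant_loop_scale HL => [k||||]; field.
  - move=> k; rewrite -[X in _ --> X]add0r -(mulr0 k.+1%:R) [a - _]addrC addrA.
    apply: cvgD; last exact: cvg_cst.
    apply: cvgB; last exact: cvg_cst.
    by apply: cvgM; [exact: cvg_cst|exact: cV].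
  - exact: cvg_cst.
  - exact: cvg_cst.
  - exact: cvg_cst.
have [x [l pE]] := exponents_cons p n0.
rewrite pE; apply: cvg_trans (mcvg x l); apply: near_eq_cvg; near=> kappa.
have k0 : 0 < kappa by near: kappa; exact: nbhs_pinfty_gt.
have [_ HM] := HK' kappa k0.
rewrite -[laguerre_low_weight _ _]/(laguerre_weight (kappa * a) kappa) HM// pE /m.
rewrite mulrA; congr (_ * _).
have -> : n = size (x :: l) by rewrite -pE size_map size_enum_ord.
by rewrite /bigrading expr1n mulr1 /= exprS mulKf// gt_eqF.
Unshelve. all: by end_near. Qed.

Lemma high_cumulant_cvg alpha a n (p : 'I_n -> nat) (K : seq nat -> R) :
  0 < alpha -> -1 < a -> (0 < n)%N -> high_loop alpha a K ->
  N%:R^-1 * mixed_cumulant (laguerre_high_weight a) (alpha / N%:R) N p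
    @[N --> \oo] --> K (map p (enum 'I_n)).
Proof.
move=> al0 a1 n0 KL.
have ex (N : nat) : exists K, (0 < N)%N ->
    cumulant_loop (fun k => 1^-1 * (k.+1%:R * (1 - alpha / N%:R) + a))
      (1^-1 * (alpha / N%:R)) (1^-1 * (alpha / N%:R)) 1^-1 N%:R K /\
    forall n (p : 'I_n -> nat), (0 < n)%N ->
      mixed_cumulant (laguerre_weight a 1) (alpha / N%:R) N p = K (map p (enum 'I_n)).
  have [N0|N0] := ltnP 0 N; last by exists (fun=> 0).
  have k0 : 0 < alpha / N%:R by rewrite divr_gt0// ltr0n.
  by have [K' HK'] := @laguerre_cumulants a 1 (alpha / N%:R) N a1 ltr01 k0; exists K'.
have [K' HK'] := choice ex.
(* Division by N turns the particle number into 1 and b2 into alpha, while b1 = alpha / N tends to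
   0. *)
pose m (N : nat) l := N%:R^-1 * (bigrading 1 1 l * K' N l).
have cV : alpha / N%:R @[N --> \oo] --> (0 : R).
  rewrite -(mulr0 alpha); apply: cvgM; first exact: cvg_cst.
  apply: (@gtr0_cvgV0 _ _ _ _ (fun N : nat => N%:R) _).2; last exact: cvgr_idn.
  by near=> N; rewrite ltr0n; near: N; exact: nbhs_infty_gt.
have mcvg : forall x l, m N (x :: l) @[N --> \oo] --> K (x :: l).
  apply: (@cumulant_loop_cvg _ _ _ _
    (fun (N : nat) k => k.+1%:R * (1 - alpha / N%:R) + a) (fun N : nat => alpha / N%:R)
    (fun=> alpha) (fun=> 1) (fun=> 1) m (fun k => k.+1%:R + a) 0 alpha 1 1) => //.
  - near=> N; have N0 : (0 < N)%N by near: N; exact: nbhs_infty_gt.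
    have [HL _] := HK' N N0.
    have Nn0 : N%:R != 0 :> R by rewrite pnatr_eq0 -lt0n.
    by apply: cumulant_loop_scale HL => [k||||]; field.
  - move=> k; have -> : k.+1%:R + a = k.+1%:R * (1 - 0) + a by rewrite subr0 mulr1.
    apply: cvgD; last exact: cvg_cst.
    apply: cvgM; first exact: cvg_cst.
    by apply: cvgB; [exact: cvg_cst|exact: cV].
  - exact: cvg_cst.
  - exact: cvg_cst.
  - exact: cvg_cst.
have [x [l pE]] := exponents_cons p n0.
rewrite pE; apply: cvg_trans (mcvg x l); apply: near_eq_cvg; near=> N.
have N0 : (0 < N)%N by near: N; exact: nbhs_infty_gt.
have [_ HM] := HK' N N0.
rewrite (_ : laguerre_high_weight a = laguerre_weight a 1); last first.
  by apply/funext => y; rewrite /laguerre_weight mul1r.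
by rewrite HM// pE /m /bigrading !expr1n !mul1r.
Unshelve. all: by end_near. Qed.

Definition low_poly : seq nat -> {poly {poly R}} := sval (cid low_poly_exists).

Definition high_poly : seq nat -> {poly {poly R}} := sval (cid high_poly_exists).

Lemma low_poly_loop (x y : R) : low_loop x y (eval2 x y \o low_poly).
Proof. exact: (svalP (cid low_poly_exists)). Qed.

Lemma high_poly_loop (x y : R) : high_loop x y (eval2 x y \o high_poly).
Proof. exact: (svalP (cid high_poly_exists)). Qed.

(** [xget] can only return this polynomial: it has the required limits, and any competitor agrees
    with it on the grid of [bivariate_eq]. *)
Lemma mu0_poly_LE n (p : 'I_n -> nat) : (0 < n)%N ->
  mu0_poly_L p = low_poly (map p (enum 'I_n)).
Proof.
move=> n0; apply: xget_unique => [N a N0 a0|P hP].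
  exact: low_cumulant_cvg (low_poly_loop _ _).
apply: bivariate_eq => i j.
have h := @low_cumulant_cvg _ _ n p _ (ltn0Sn i) (ler0n R j) n0 (low_poly_loop _ _).
exact: cvg_unique (hP _ _ (ltn0Sn i) (ler0n R j)) h.
Qed.

Lemma mu0_poly_LsE n (p : 'I_n -> nat) : (0 < n)%N ->
  mu0_poly_Ls p = high_poly (map p (enum 'I_n)).
Proof.
move=> n0; apply: xget_unique => [alpha a al0 a1|P hP].
  exact: high_cumulant_cvg (high_poly_loop _ _).
apply: bivariate_eq => i j.
have i0 : 0 < i.+1%:R :> R by rewrite ltr0n.
have j1 : -1 < j%:R :> R by rewrite (lt_le_trans (ltrN10 R)).
have h := @high_cumulant_cvg _ _ n p _ i0 j1 n0 (high_poly_loop _ _).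
exact: cvg_unique (hP _ _ i0 j1) h.
Qed.

(** Both sides solve [low_loop N a], at arbitrary real parameters, and its solution is unique on
    nonempty words. *)
Lemma mu0_L_duality n (p : 'I_n -> nat) (N a : R) : (0 < n)%N ->
  mu0_L N a p = - N * ((-1) ^+ (\sum_(i < n) p i + n)%N * mu0_Ls (- N) (- a) p).
Proof.
move=> n0; rewrite /mu0_L /mu0_Ls mu0_poly_LE// mu0_poly_LsE//.
have [x [l pE]] := exponents_cons p n0.
have hL := low_poly_loop N a.
have hH := low_high_loop (high_poly_loop (- N) (- a)).
rewrite pE -[LHS]/((eval2 N a \o low_poly) (x :: l)).
rewrite (cumulant_loop_unique hL hH) -pE /bigrading size_map size_enum_ord.
by rewrite sumnE big_map big_enum/= -exprD addnC.
Qed.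

End limits.

Theorem corollary3p4 (R : realType) (n : nat) (hn : (0 < n)%N) :
  (* the leading terms exist, and are given coefficientwise by polynomials *)
  (forall (N : nat) (a : R) (e : 'I_n -> nat), (0 < N)%N -> 0 <= a ->
     kappa ^+ n.-1 * W_L N kappa a e @[kappa --> +oo] --> W0_L N%:R a e) /\
  (forall (alpha a : R) (e : 'I_n -> nat), 0 < alpha -> -1 < a ->
     N%:R^-1 * W_Ls N (alpha / N%:R) a e @[N --> \oo] --> W0_Ls alpha a e) /\
  (* duality of the generating functions *)
  (forall N a : R, N != 0 ->
     series_scale (- N^-1) (@W0_L R n N a) =
     series_opp_args (@W0_Ls R n (- N) (- a))) /\
  (* duality of the coefficients *)
  (forall (N a : R) (p : 'I_n -> nat), N != 0 ->
     N^-1 * mu0_L N a p =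
     (-1) ^+ ((\sum_(i < n) p i) + n - 1)%N * mu0_Ls (- N) (- a) p).
Proof.
split; [|split; [|split]].
- move=> N a e N0 a0; rewrite /W_L /W0_L /generating_series; case: ifP => _.
    by rewrite /mu0_L mu0_poly_LE//; exact: low_cumulant_cvg (low_poly_loop _ _).
  by under eq_fun do rewrite mulr0; exact: cvg_cst.
- move=> alpha a e al0 a1; rewrite /W_Ls /W0_Ls /generating_series; case: ifP => _.
    by rewrite /mu0_Ls mu0_poly_LsE//; exact: high_cumulant_cvg (high_poly_loop _ _).
  by under eq_fun do rewrite mulr0; exact: cvg_cst.
- move=> N a N0; apply/funext => e.
  rewrite /series_scale /series_opp_args /W0_L /W0_Ls /generating_series.
  case: ifPn => [/forallP e0|_]; last by rewrite !mulr0.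
  (* The exponents of the series are e i = p i + 1, so the sign from negating the arguments already
     contains (-1)^n. *)
  rewrite mu0_L_duality// mulNr mulNr mulrN opprK mulKf//; congr (_ ^+ _ * _).
  rewrite -[X in (_ + X)%N](card_ord n) -sum1_card -big_split/=.
  by apply: eq_bigr => i _; rewrite addn1 prednK.
- move=> N a p N0; rewrite mu0_L_duality// mulNr mulrN mulKf// -mulNr; congr (_ * _).
  (* For n = m + 1 the truncated [n - 1] is exact, and the remaining minus sign is absorbed by one
     factor -1. *)
  case: n hn p => [//|m] _ p.
  by rewrite addnS subn1 /= exprS mulN1r opprK.
Qed.
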